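(* Let $n\ge1$ and let $u>0$ be a smooth solution of the heat equation $\partial_t u=\Delta_x u$ on $\mathbb{R}^n\times[0,\infty)$ (continuous up to $t=0$) with $u$, $\partial_t u$, $\partial_t^2u$ bounded. For $N\ge3$, $m=n+N$, define $v(x,y)=(2N)^{-n/2}|y|^{2-N}u\big(x,\tfrac{|y|^2}{2N}\big)$ on $\mathbb{R}^n\times(\mathbb{R}^N\setminus\{0\})$. Fix $\tau>0$, let $R=\sqrt{2N\tau}$, choose $\bar y\in\mathbb{R}^N$ with $|\bar y|=R$, and set $\bar z=(0,\bar y)\in\mathbb{R}^m$. Then \[ \lim_{N\to\infty}R^{m-2}v(\bar z)=(4\pi)^{-n/2}\int_{\mathbb{R}^n}u(x,0)\,e^{-\frac{|x|^2}{4\tau}}\,dx . \] Consequently the log Sobolev inequality holds, in the form: if $\int_{\mathbb{R}^n}u(x,t)\,dx=1$, then for all $t>0$, \[ \mathcal{W}(t):=t\int\frac{|\nabla_x u|^2}{u}\,dx-\int u\log u\,dx-\frac n2\log t\ \ge\ n+\frac n2\log(4\pi). \]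
   Context: $\mathbb{R}^m=\mathbb{R}^n\times\mathbb{R}^N$ with points $(x,y)$. The function $v$ equals $r^{2-m}e^{-f(x,r^2/(2N))}$ where $r=|y|$ and $u=t^{-n/2}e^{-f}$; it is an ''almost harmonic'' function on $\mathbb{R}^m$. *)

(* Defs.v *)
From HB Require Import structures.
From mathcomp Require Import all_boot all_order all_algebra.
From mathcomp Require Import all_classical all_reals all_analysis.
Set Implicit Arguments. Unset Strict Implicit. Unset Printing Implicit Defensive.
Import Order.TTheory GRing.Theory Num.Theory.
Import numFieldNormedType.Exports.
Local Open Scope classical_set_scope.
Local Open Scope ring_scope.

Section Defs.
Variable R : realType.

Fixpoint Ck {V : normedModType R} (k : nat) (D : set V) (f : V -> R) : Prop :=
  match k with
  | 0 => forall p, D p -> {for p, continuous f}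
  | k'.+1 => (forall p, D p -> differentiable f p) /\
             forall w : V, Ck k' D ('D_w f)
  end.

Definition smooth_on {V : normedModType R} (D : set V) (f : V -> R) : Prop :=
  forall k, Ck k D f.

(* Euclidean norm on R^N (the library norm on 'rV is the sup norm). *)
Definition enorm {N : nat} (y : 'rV[R]_N) : R :=
  Num.sqrt (\sum_(i < N) y ord0 i ^+ 2).

Definition uncurry_st {n : nat} (u : 'rV[R]_n -> R -> R) : 'rV[R]_n * R -> R :=
  fun p => u p.1 p.2.

Definition dir_t {n : nat} : 'rV[R]_n * R := (0, 1).
Definition dir_x {n : nat} (i : 'I_n) : 'rV[R]_n * R := (delta_mx ord0 i, 0).

(* Lebesgue integral over R^n of a nonnegative (extended-real valued)
   function, computed as the iterated one-dimensional Lebesgue integral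
   (equal to the integral against n-dimensional Lebesgue measure by Tonelli). *)
Fixpoint int_Rn (n : nat) : ('rV[R]_n -> \bar R) -> \bar R :=
  match n return ('rV[R]_n -> \bar R) -> \bar R with
  | 0 => fun f => f 0
  | k.+1 => fun f =>
      (\int[@lebesgue_measure R]_(a in setT)
         int_Rn (fun x : 'rV[R]_k => f (row_mx (\row_(j < 1) a) x)))%E
  end.

Definition sint_Rn (n : nat) (f : 'rV[R]_n -> R) : \bar R :=
  (int_Rn (fun x => (Num.max (f x) 0)%:E) -
   int_Rn (fun x => (Num.max (- f x) 0)%:E))%E.

Definition vfun (n N : nat) (u : 'rV[R]_n -> R -> R)
  (x : 'rV[R]_n) (y : 'rV[R]_N) : R :=
  (2 * N%:R) `^ (- (n%:R / 2)) * (enorm y) `^ (2 - N%:R)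
  * u x (enorm y ^+ 2 / (2 * N%:R)).

Definition grad_sq {n : nat} (u : 'rV[R]_n -> R -> R) (x : 'rV[R]_n) (t : R) : R :=
  \sum_(i < n) ('D_(dir_x i) (uncurry_st u) (x, t)) ^+ 2.

Definition Wfun {n : nat} (u : 'rV[R]_n -> R -> R) (t : R) : \bar R :=
  (t%:E * int_Rn (fun x => (grad_sq u x t / u x t)%:E)
   - sint_Rn (fun x => (u x t * ln (u x t))%R)
   - (n%:R / 2 * ln t)%:E)%E.

End Defs.
Arguments dir_t {R n}.
Arguments dir_x {R n}.

(* Main.v *)
(* A bounded solution is the heat-kernel average of its initial value: for
   Psi(s) = \int u(x,s) G_(T-s)(x - z) dx, cut off to a compact set, Green's formula
   makes Psi' small, so that Psi is constant once the cutoff is removed; taking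
   the endpoints s, t with T = s + t gives \int u_s G_t = \int u_t G_s, and
   s -> 0 turns the right-hand side into u(z,t). With |y|^2 = 2 N tau all powers
   of R cancel: R^(m-2) v = tau^(n/2) u(0,tau) does not depend on N, so the first
   claim is the representation formula at (0,tau).

   The log-Sobolev inequality is proved by tensorization. For one coordinate, the
   marginal p of u(.,t) is transported monotonically by T onto the Gaussian g of
   variance 2t: p = M (g o T) T' and ln T' <= T' - 1 give
   \int p ln(p/M) <= \int p (ln g(T) + T' - 1), and \int T' p is integrated by parts and
   estimated by AM-GM, so that the Gaussian constants come out exactly. Since
   u(.,t) is only known to be positive and integrable, continuity of the
   marginals is obtained from the Harnack inequality
   u(x,s) <= C u(y,2s) for |x - y| <= 1, applied along the times 2^j t. *)

Require Import Defs.
From HB Require Import structures.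
From mathcomp Require Import all_boot all_order all_algebra.
From mathcomp Require Import all_classical all_reals all_analysis.
From mathcomp Require Import measurable_realfun ring lra.
Set Implicit Arguments. Unset Strict Implicit. Unset Printing Implicit Defensive.
Import Order.TTheory GRing.Theory Num.Theory.
Import numFieldNormedType.Exports.
Local Open Scope classical_set_scope.
Local Open Scope ring_scope.

(** * Lebesgue measure on row vectors *)

(** No bound on the space derivatives of [u] is given, so boundary terms at infinity cannot be
    discarded directly. The cutoff makes Green's formula exact, and every later estimate uses only
    the bounds on [u] and its time derivative. With T = s + t the time of the kernel stays between s
    and t, away from its singularity. In the entropy part the variance 2t is dictated by the weight
    t of the Fisher information: AM-GM bounds - D T by t D^2 / f + T^2 f / (4t), and ln g(T)
    contains exactly - T^2 / (4t), so the second moments cancel, provided that they are finite. The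
    integration by parts is done on the function along lines, since its marginal is only known to be
    continuous. Slices of a probability density are not normalised, hence an induction over positive
    functions of arbitrary mass M. Entropy and Fisher information may be infinite; positive and
    negative parts are therefore kept on opposite sides of each inequality in the extended reals. *)

Definition rV_display : measure_display -> measure_display.
Proof. exact. Qed.

Section rV_measurable.
Context {R : realType} (n : nat).

Let coord (i : 'I_n) (x : 'rV[R]_n) := x ord0 i.

Let rV_set0 : g_sigma_preimage coord set0.
Proof. exact: sigma_algebra0. Qed.

Let rV_setC A : g_sigma_preimage coord A -> g_sigma_preimage coord (~` A).
Proof. exact: sigma_algebraC. Qed.

Let rV_bigcup (F : _^nat) : (forall i, g_sigma_preimage coord (F i)) ->
  g_sigma_preimage coord (\bigcup_i (F i)).
Proof. exact: sigma_algebra_bigcup. Qed.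

HB.instance Definition _ := @isMeasurable.Build (rV_display default_measure_display)
  'rV[R]_n (g_sigma_preimage coord) rV_set0 rV_setC rV_bigcup.

Lemma measurable_coord (i : 'I_n) :
  measurable_fun [set: 'rV[R]_n] (fun x => x ord0 i).
Proof.
move=> _ Y mY; rewrite setTI; apply: sub_sigma_algebra => /=.
rewrite -bigcup_seq/=; exists i => /=; first by rewrite mem_index_enum.
by exists Y => //; rewrite setTI.
Qed.

Lemma measurable_rVP d (T : measurableType d) (f : T -> 'rV[R]_n) :
  (forall i, measurable_fun [set: T] (fun t => f t ord0 i)) ->
  measurable_fun [set: T] f.
Proof.
move=> mf _ A; move: A; apply: smallest_sub.
  split.
  - by rewrite preimage_set0 setI0.
  - by move=> A; rewrite !setTI => mA; rewrite setTD preimage_setC; exact: measurableC.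
  - move=> F mF; rewrite preimage_bigcup setTI; apply: bigcup_measurable => k _.
    by have := mF k; rewrite setTI.
rewrite -bigcup_seq; apply: bigcup_sub => i _ _ [B mB <-].
by rewrite !setTI -comp_preimage; have := mf i measurableT _ mB; rewrite setTI.
Qed.

(** An open set is the union of the rational boxes that it contains. These are countably many, and
    in the sup norm a box is a finite intersection of conditions on single coordinates. *)
Lemma open_rV_measurable (O : set (@matrix R 1 n)) : open O -> measurable O.
Proof.
move=> oO.
pose B (p : 'rV[rat]_n * rat) : set 'rV[R]_n :=
  [set x | forall i, `|ratr (p.1 ord0 i) - x ord0 i| < ratr p.2].
have mB p : measurable (B p).
  have -> : B p = \bigcap_(i in [set: 'I_n])
     ((fun x : 'rV[R]_n => x ord0 i) @^-1`
        ball (ratr (p.1 ord0 i) : R) (ratr p.2)).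
    apply/seteqP; split => x /= h i => [_|]; first exact: h.
    exact: (h i).
  apply: fin_bigcap_measurable; first exact: finite_finset.
  move=> i _; rewrite -[X in measurable X]setTI; apply: measurable_coord => //.
  exact: measurable_ball.
have -> : O = \bigcup_(p in [set p | B p `<=` O]) B p.
  apply/seteqP; split; last by move=> x [p /= pO px]; exact: pO.
  move=> x Ox; have /nbhs_ballP[e /= e0 xe] : nbhs x O by exact: open_nbhs_nbhs.
  (* With r < e/2 and a centre within r of x, every point of the box lies within 2r < e of x. *)
  have [r] := rat_in_itvoo (divr_gt0 e0 (@ltr0Sn R 1)).
  rewrite in_itv/= => /andP[r0 re].
  have /choice[q qx] : forall i, exists q : rat, `|ratr q - x ord0 i| < ratr r.
    move=> i.
    have : x ord0 i - ratr r < x ord0 i + ratr r by rewrite ltrBlDr -addrA ltrDl addr_gt0.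
    move=> /rat_in_itvoo[q]; rewrite in_itv/= => /andP[h1 h2].
    exists q; rewrite ltr_norml; lra.
  exists (\row_i q i, r) => /=; last by move=> i /=; rewrite mxE.
  move=> y By; apply: xe; split => //.
  move=> i j; rewrite (ord1 i) -ball_normE/=.
  have := By j; rewrite /= mxE => h.
  have -> : x ord0 j - y ord0 j = (x ord0 j - ratr (q j)) + (ratr (q j) - y ord0 j) by ring.
  rewrite (le_lt_trans (ler_normD _ _))//.
  have := qx j; rewrite distrC => ?; lra.
rewrite bigcup_mkcond; apply: countable_bigcupT_measurable => [|p]; first exact: countableP.
by case: ifP.
Qed.
End rV_measurable.

Section rV_measure.
Context {R : realType}.
Local Open Scope ereal_scope.

Lemma continuous_rV_measurable n (f : 'rV[R]_n -> R) :
  continuous f -> measurable_fun setT f.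
Proof.
move=> /continuousP cf; apply: (measurability _ (RGenOpens.measurableE R)).
move=> _ [_ [a [b ->] <-]]; rewrite setTI.
by apply: open_rV_measurable; apply: cf; exact: interval_open.
Qed.

(** Spelled with the same [row_mx] as [int_Rn], so that the iterated integral and the measure below
    unfold in step. *)
Definition rcons0 n (p : measurableTypeR R * 'rV[R]_n) : 'rV[R]_n.+1 := row_mx (\row_(j < 1) p.1) p.2.

Lemma rcons0E n (p : measurableTypeR R * 'rV[R]_n) i :
  rcons0 p ord0 i = if unlift ord0 i is Some j then p.2 ord0 j else p.1.
Proof.
rewrite /rcons0; case: unliftP => [j|] ->.
  have -> : lift ord0 j = @rshift 1 n j by apply: val_inj.
  exact: (row_mxEr (\row__ p.1) p.2).
have -> : ord0 = @lshift 1 n ord0 by apply: val_inj.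
by rewrite [LHS](row_mxEl (\row__ p.1) p.2) mxE.
Qed.

Lemma rcons0_0 n (p : measurableTypeR R * 'rV[R]_n) : rcons0 p ord0 ord0 = p.1.
Proof. by rewrite rcons0E unlift_none. Qed.

Lemma rcons0_lift n (p : measurableTypeR R * 'rV[R]_n) j : rcons0 p ord0 (lift ord0 j) = p.2 ord0 j.
Proof. by rewrite rcons0E liftK. Qed.

Lemma measurable_rcons0 n : measurable_fun setT (@rcons0 n).
Proof.
apply: measurable_rVP => i; under eq_fun do rewrite rcons0E.
case: unliftP => [j|] _; last exact: measurable_fst.
by apply: (measurableT_comp (measurable_coord j)); exact: measurable_snd.
Qed.

Definition uncons n (x : 'rV[R]_n.+1) : measurableTypeR R * 'rV[R]_n :=
  (x ord0 ord0, \row_j x ord0 (lift ord0 j)).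

Lemma unconsK n : cancel (@uncons n) (@rcons0 n).
Proof.
move=> x; apply/rowP => i; rewrite rcons0E; case: unliftP => [j|] -> //=.
by rewrite mxE.
Qed.

Lemma rcons0K n : cancel (@rcons0 n) (@uncons n).
Proof.
move=> [a x]; rewrite /uncons rcons0_0; congr pair.
by apply/rowP => j; rewrite mxE rcons0_lift.
Qed.

Lemma measurable_uncons n : measurable_fun setT (@uncons n).
Proof.
apply: measurable_fun_pair; first exact: measurable_coord.
by apply: measurable_rVP => i; under eq_fun do rewrite mxE; exact: measurable_coord.
Qed.

Section step.
Variables (n : nat) (mu : {sigma_finite_measure set 'rV[R]_n -> \bar R}).
Let nu := pushforward (@lebesgue_measure R \x mu) (@rcons0 n).

Let nu0 : nu set0 = 0. Proof. by rewrite /nu /pushforward preimage_set0 measure0. Qed.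
Let nu_ge0 A : 0 <= nu A. Proof. by rewrite /nu /pushforward; exact: measure_ge0. Qed.
Let nu_add : semi_sigma_additive nu.
Proof.
move=> F mF tF mUF; rewrite /nu /pushforward preimage_bigcup.
apply: measure_sigma_additive.
  by move=> i; rewrite -[X in measurable X]setTI; exact: measurable_rcons0.
by apply/trivIsetP => /= i j _ _ ij; rewrite -preimage_setI; move/trivIsetP: tF => ->//; rewrite preimage_set0.
Qed.

Definition rV_step := nu.
HB.instance Definition _ := isMeasure.Build _ _ _ rV_step nu0 nu_ge0 nu_add.

Let rV_step_sigma_finite : sigma_finite setT rV_step.
Proof.
have /sigma_finiteP[F [TF ndF Foo]] := sigma_finiteT (@lebesgue_measure R).
have /sigma_finiteP[G [TG ndG Goo]] := sigma_finiteT mu.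
(* Both exhausting sequences are nondecreasing, so the larger of two indices serves for both
   factors. *)
exists (fun k => @uncons n @^-1` (F k `*` G k)).
  apply/seteqP; split => // x _.
  have [k _ Fk] : (\bigcup_i F i) (uncons x).1 by rewrite -TF.
  have [l _ Gl] : (\bigcup_i G i) (uncons x).2 by rewrite -TG.
  exists (maxn k l) => //; split.
    by move: Fk; exact/subsetPset/ndF/leq_maxl.
  by move: Gl; exact/subsetPset/ndG/leq_maxr.
move=> k; have [mF Fk] := Foo k; have [mG Gk] := Goo k; split.
  by rewrite -[X in measurable X]setTI; apply: measurable_uncons => //; exact: measurableX.
rewrite /rV_step /nu /pushforward -comp_preimage.
have -> : @uncons n \o @rcons0 n = id by apply/funext => x /=; rewrite rcons0K.
by rewrite preimage_id product_measure1E// lte_mul_pinfty// ge0_fin_numE.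
Qed.
HB.instance Definition _ := Measure_isSigmaFinite.Build _ _ _ rV_step rV_step_sigma_finite.
End step.

(** Lebesgue measure built along the recursion of [int_Rn]. As a sigma-finite measure it gives
    Tonelli, Fubini, domination and differentiation under the integral, none of which applies to an
    iterated integral as such. *)
Fixpoint rVmeas n : {sigma_finite_measure set 'rV[R]_n -> \bar R} :=
  match n return {sigma_finite_measure set 'rV[R]_n -> \bar R} with
  | 0 => @dirac _ 'rV[R]_0 (0%R : 'rV[R]_0) R
  | k.+1 => rV_step (rVmeas k)
  end.

Lemma ge0_integral_rV_S n (f : 'rV[R]_n.+1 -> \bar R) :
  measurable_fun setT f -> (forall x, 0 <= f x) ->
  \int[rVmeas n.+1]_x f x = \int[@lebesgue_measure R]_a \int[rVmeas n]_x f (rcons0 (a, x)).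
Proof.
move=> mf f0.
have := @ge0_integral_pushforward _ _ _ _ R _ (@measurable_rcons0 n)
  (@lebesgue_measure R \x rVmeas n) setT f measurableT mf (fun y _ => f0 y).
rewrite preimage_setT => ->.
exact: fubini_tonelli1 (measurableT_comp mf (@measurable_rcons0 n)) (fun p => f0 _).
Qed.

Lemma int_RnE n (f : 'rV[R]_n -> \bar R) :
  measurable_fun setT f -> (forall x, 0 <= f x) -> int_Rn f = \int[rVmeas n]_x f x.
Proof.
elim: n f => [|n IH] f mf f0.
  by rewrite integral_dirac//= diracT mul1e.
rewrite ge0_integral_rV_S//=; apply: eq_integral => a _.
rewrite -IH//; apply: (measurableT_comp mf).
by apply: (measurableT_comp (@measurable_rcons0 n)); exact: measurable_pair1.
Qed.

Lemma integral_rV_S n (f : 'rV[R]_n.+1 -> \bar R) :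
  (rVmeas n.+1).-integrable setT f ->
  \int[rVmeas n.+1]_x f x = \int[@lebesgue_measure R]_a \int[rVmeas n]_x f (rcons0 (a, x))
  /\ \int[rVmeas n.+1]_x f x = \int[rVmeas n]_x \int[@lebesgue_measure R]_a f (rcons0 (a, x)).
Proof.
move=> fi.
have /integrableP[mf foo] := fi.
have mr := @measurable_rcons0 n.
have h : (@lebesgue_measure R \x rVmeas n).-integrable setT (f \o @rcons0 n).
  apply/integrableP; split; first exact: measurableT_comp mf mr.
  have maf : measurable_fun setT (abse \o f) by exact: measurableT_comp.
  have := @ge0_integral_pushforward _ _ _ _ R _ mr
    (@lebesgue_measure R \x rVmeas n) setT _ measurableT maf (fun y _ => abse_ge0 _).
  by rewrite preimage_setT => /= <-.
have -> : \int[rVmeas n.+1]_x f x = \int[@lebesgue_measure R \x rVmeas n]_p (f \o @rcons0 n) p.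
  have := @integral_pushforward _ _ _ _ R _ mr (@lebesgue_measure R \x rVmeas n) setT f mf.
  by rewrite preimage_setT => /(_ h measurableT).
by split; [have := integral12_prod_meas1 h | have := integral21_prod_meas1 h]; move=> <-.
Qed.

Lemma ge0_integral_rV_S_swap n (f : 'rV[R]_n.+1 -> \bar R) :
  measurable_fun setT f -> (forall x, 0 <= f x) ->
  \int[rVmeas n.+1]_x f x = \int[rVmeas n]_x \int[@lebesgue_measure R]_a f (rcons0 (a, x)).
Proof.
move=> mf f0; rewrite ge0_integral_rV_S//.
exact: fubini_tonelli (measurableT_comp mf (@measurable_rcons0 n)) (fun p => f0 _).
Qed.

Lemma measurable_slice n (f : 'rV[R]_n.+1 -> \bar R) a :
  measurable_fun setT f -> measurable_fun setT (fun x => f (rcons0 (a, x))).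
Proof.
move=> mf; apply: (measurableT_comp mf).
by apply: (measurableT_comp (@measurable_rcons0 n)); exact: measurable_pair1.
Qed.

Lemma measurable_integral_slice n (f : 'rV[R]_n.+1 -> \bar R) :
  measurable_fun setT f -> (forall x, 0 <= f x) ->
  measurable_fun [set: measurableTypeR R] (fun a => \int[rVmeas n]_x f (rcons0 (a, x))).
Proof.
move=> mf f0.
exact: measurable_fun_fubini_tonelli_F (measurableT_comp mf (@measurable_rcons0 n))
  (fun p => f0 _).
Qed.

Lemma continuous_rVP n (T : topologicalType) (f : T -> 'rV[R]_n) (t : T) :
  (forall i, f s ord0 i @[s --> t] --> f t ord0 i) -> f s @[s --> t] --> f t.
Proof.
move=> cf; apply/cvg_ballP => e e0; near=> s; split => // i j.
rewrite (ord1 i); move: j; near: s; apply: filter_forall => j.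
by have /cvg_ballP := cf j; exact.
Unshelve. all: by end_near. Qed.

Lemma continuous_rcons0r n (a : R) : continuous (fun x : 'rV[R]_n => rcons0 (a, x)).
Proof.
move=> x; apply: continuous_rVP => i; rewrite rcons0E.
under eq_fun do rewrite rcons0E.
case: unliftP => [j|] _ /=; first exact: coord_continuous.
by move=> A Aa; apply: (@nearW _ (nbhs x) (fun=> A a)) => y; exact: (nbhs_singleton Aa).
Qed.

Lemma continuous_rcons0l n x : continuous (fun a : R => rcons0 (a, x) : 'rV[R]_n.+1).
Proof.
move=> a; apply: continuous_rVP => i; rewrite rcons0E.
under eq_fun do rewrite rcons0E.
by case: unliftP => [j|] _ /=; [exact: cvg_cst|].
Qed.

Lemma rcons0D n (p q : R * 'rV[R]_n) :
  (rcons0 p + rcons0 q = rcons0 (p.1 + q.1, p.2 + q.2))%R.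
Proof. by apply/rowP => i; rewrite mxE !rcons0E; case: unliftP => //= j; rewrite mxE. Qed.

Lemma rcons0N n (p : R * 'rV[R]_n) : (- rcons0 p = rcons0 (- p.1, - p.2))%R.
Proof. by apply/rowP => i; rewrite mxE !rcons0E; case: unliftP => //= j; rewrite mxE. Qed.

End rV_measure.

(** * The Gaussian heat kernel *)

Section heat_kernel.
Context {R : realType}.

Lemma cvg_sum_ord {T : Type} (F : set_system T) {FF : Filter F} n
    (f : 'I_n -> T -> R) (l : 'I_n -> R) :
  (forall i, f i x @[x --> F] --> l i) ->
  (\sum_(i < n) f i x) @[x --> F] --> \sum_(i < n) l i.
Proof.
elim: n f l => [|n IH] f l fl.
  by rewrite big_ord0; under eq_fun do rewrite big_ord0; exact: cvg_cst.
rewrite big_ord_recl; under eq_fun do rewrite big_ord_recl.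
by apply: cvgD; [exact: fl|apply: IH => i; exact: fl].
Qed.

Definition sqn n (x : 'rV[R]_n) : R := \sum_(i < n) x ord0 i ^+ 2.

Lemma sqn_ge0 n (x : 'rV[R]_n) : 0 <= sqn x.
Proof. by apply: sumr_ge0 => i _; exact: sqr_ge0. Qed.

Lemma enormE n (x : 'rV[R]_n) : enorm x ^+ 2 = sqn x.
Proof. by rewrite sqr_sqrtr// sqn_ge0. Qed.

Lemma sqn_rcons0 n (p : R * 'rV[R]_n) : sqn (rcons0 p) = p.1 ^+ 2 + sqn p.2.
Proof.
rewrite /sqn big_ord_recl rcons0_0; congr +%R.
by apply: eq_bigr => i _; rewrite rcons0_lift.
Qed.

Lemma continuous_sqn n (z : 'rV[R]_n) : continuous (fun x : 'rV[R]_n => sqn (x - z)).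
Proof.
move=> x; apply: (@cvg_sum_ord _ (nbhs x)) => i; rewrite !mxE expr2.
under eq_fun do rewrite !mxE expr2.
by apply: cvgM; apply: cvgB; (exact: coord_continuous || exact: cvg_cst).
Qed.

Definition heat n (s : R) (z x : 'rV[R]_n) : R :=
  (Num.sqrt (4 * pi * s))^-1 ^+ n * expR (- sqn (x - z) / (4 * s)).

Lemma heat_ge0 n s (z x : 'rV[R]_n) : 0 <= heat s z x.
Proof. by rewrite mulr_ge0 ?expR_ge0// exprn_ge0// invr_ge0 sqrtr_ge0. Qed.

Lemma continuous_heat n s (z : 'rV[R]_n) : continuous (heat s z).
Proof.
move=> x; apply: (@cvgM _ _ (nbhs x)); first exact: cvg_cst.
apply: (@cvg_comp _ _ _ (fun y => - sqn (y - z) / (4 * s)) (@expR R)); last exact: continuous_expR.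
by apply: (@cvgM _ _ (nbhs x)); [apply: (@cvgN _ _ _ (nbhs x)); exact: continuous_sqn|exact: cvg_cst].
Qed.

(** The kernel at time s is a product of normal densities of variance 2s; mass and domination then
    follow by induction on the dimension. *)
Lemma heat_rcons0 n s (z : 'rV[R]_n.+1) p : 0 < s ->
  heat s z (rcons0 p) =
  normal_pdf (z ord0 ord0) (Num.sqrt (2 * s)) p.1 * heat s (uncons z).2 p.2.
Proof.
move=> s0; have s20 : Num.sqrt (2 * s) != 0 by rewrite gt_eqF// sqrtr_gt0 mulr_gt0.
rewrite /heat.
have -> : rcons0 p - z = rcons0 (p.1 - (uncons z).1, p.2 - (uncons z).2).
  by rewrite -[z in LHS]unconsK rcons0N rcons0D.
rewrite normal_pdfE// sqn_rcons0 /= /normal_peak /normal_fun sqr_sqrtr ?mulr_ge0 1?ltW//.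
have -> : 2 * s * pi *+ 2 = 4 * pi * s by ring.
have -> : 2 * s *+ 2 = 4 * s by ring.
set A := (_ - _) ^+ 2; set B := sqn _.
have -> : expR (- (A + B) / (4 * s)) = expR (- A / (4 * s)) * expR (- B / (4 * s)).
  by rewrite -expRD; congr expR; ring.
rewrite exprS; ring.
Qed.

Lemma measurable_heat n s (z : 'rV[R]_n) : measurable_fun setT (heat s z).
Proof. by apply: continuous_rV_measurable; exact: continuous_heat. Qed.

Lemma integral_heat n s (z : 'rV[R]_n) : 0 < s ->
  (\int[rVmeas n]_x (heat s z x)%:E = 1)%E.
Proof.
move=> s0; elim: n z => [|n IH] z.
  rewrite [LHS]integral_dirac//; last by apply/measurable_EFinP; exact: measurable_heat.
  by rewrite diracT mul1e /heat /sqn big_ord0 oppr0 mul0r expr0 expR0 mul1r.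
rewrite ge0_integral_rV_S//; last 2 first.
- by apply/measurable_EFinP; exact: measurable_heat.
- by move=> x; rewrite lee_fin heat_ge0.
rewrite -[RHS](integral_normal_pdf (z ord0 ord0) (Num.sqrt (2 * s))).
apply: eq_integral => a _.
under eq_integral do rewrite (heat_rcons0 _ _ s0) EFinM /=.
rewrite ge0_integralZl//; last 3 first.
- by apply/measurable_EFinP; exact: measurable_heat.
- by move=> x _; rewrite lee_fin heat_ge0.
- by rewrite lee_fin normal_pdf_ge0.
by rewrite IH mule1.
Qed.

Lemma integrable_heat n s (z : 'rV[R]_n) : 0 < s ->
  (rVmeas n).-integrable setT (EFin \o heat s z).
Proof.
move=> s0; apply/integrableP; split; first by apply/measurable_EFinP; exact: measurable_heat.
under eq_integral do rewrite /= ger0_norm ?heat_ge0//.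
by rewrite integral_heat// ltry.
Qed.

Lemma heat_norm_double n (s : R) : 0 < s ->
  (Num.sqrt (4 * pi * s))^-1 ^+ n = Num.sqrt 2 ^+ n * (Num.sqrt (4 * pi * (2 * s)))^-1 ^+ n.
Proof.
move=> s0; rewrite -exprMn; congr (_ ^+ n).
rewrite (_ : 4 * pi * (2 * s) = 2 * (4 * pi * s)); last by ring.
by rewrite [in RHS]sqrtrM// invfM mulrA divff ?mul1r// gt_eqF// sqrtr_gt0.
Qed.

(* [q e^{-q/(4s)} <= 8 s e^{-q/(8s)}] *)
Lemma sqn_heat_le n s (z x : 'rV[R]_n) : 0 < s ->
  sqn (x - z) * heat s z x <= 8 * s * Num.sqrt 2 ^+ n * heat (2 * s) z x.
Proof.
move=> s0; rewrite /heat; set q := sqn _.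
rewrite heat_norm_double//.
set c := (Num.sqrt (4 * pi * (2 * s)))^-1 ^+ n.
have c0 : 0 <= Num.sqrt 2 ^+ n * c.
  by rewrite mulr_ge0// exprn_ge0 ?invr_ge0 ?sqrtr_ge0.
rewrite (_ : 4 * (2 * s) = 8 * s); last by ring.
have -> : expR (- q / (4 * s)) = expR (- q / (8 * s)) * expR (- q / (8 * s)).
  by rewrite -expRD; congr expR; field; rewrite gt_eqF.
set e := expR (- q / (8 * s)).
have e0 : 0 < e by exact: expR_gt0.
have qe : q * e <= 8 * s.
  have s8 : 0 < 8 * s by rewrite mulr_gt0.
  have : q / (8 * s) <= expR (q / (8 * s)) by rewrite (le_trans _ (expR_ge1Dx _))// lerDr.
  rewrite ler_pdivrMr// => h; rewrite (le_trans (ler_wpM2r (ltW e0) h))//.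
  by rewrite mulrAC -expRD mulNr subrr expR0 mul1r.
have := ler_wpM2l c0 (ler_wpM2r (ltW e0) qe).
by congr (_ <= _); ring.
Qed.

End heat_kernel.

(** * Derivative rules in one variable *)

Section calculus.
Context {R : realType}.
Implicit Types (f g : R -> R) (x a b : R).

Lemma derD f g x a b : is_derive x 1 f a -> is_derive x 1 g b ->
  is_derive x 1 (fun y => f y + g y) (a + b).
Proof. exact: is_deriveD. Qed.

Lemma derB f g x a b : is_derive x 1 f a -> is_derive x 1 g b ->
  is_derive x 1 (fun y => f y - g y) (a - b).
Proof. exact: is_deriveB. Qed.

Lemma derN f x a : is_derive x 1 f a -> is_derive x 1 (fun y => - f y) (- a).
Proof. exact: is_deriveN. Qed.

Lemma derM f g x a b : is_derive x 1 f a -> is_derive x 1 g b ->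
  is_derive x 1 (fun y => f y * g y) (f x * b + a * g x).
Proof. by move=> fa gb; apply: (is_derive_eq (is_deriveM fa gb)); rewrite [a * _]mulrC. Qed.

Lemma derMl f x a b : is_derive x 1 f a -> is_derive x 1 (fun y => b * f y) (b * a).
Proof. exact: is_deriveZ. Qed.

Lemma der_comp f g x a b : is_derive (g x) 1 f a -> is_derive x 1 g b ->
  is_derive x 1 (fun y => f (g y)) (a * b).
Proof. exact: is_derive1_comp. Qed.

Lemma derX f n x a : is_derive x 1 f a ->
  is_derive x 1 (fun y => f y ^+ n.+1) (n.+1%:R * f x ^+ n * a).
Proof.
move=> fa; elim: n => [|n IH].
  by rewrite expr0 !mul1r; under eq_fun do rewrite expr1.
under eq_fun do rewrite exprS.
apply: (is_derive_eq (derM fa IH)); rewrite -[n.+2%:R]natr1 !exprS; ring.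
Qed.

Lemma der_exp f x a : is_derive x 1 f a ->
  is_derive x 1 (fun y => expR (f y)) (expR (f x) * a).
Proof. by move=> fa; apply: der_comp. Qed.

Lemma der_cst x a : is_derive x 1 (fun=> a) 0.
Proof. exact: is_derive_cst. Qed.

Lemma der_continuous f x a : is_derive x 1 f a -> {for x, continuous f}.
Proof. by move=> [df _]; apply/differentiable_continuous/derivable1_diffP. Qed.

(** Away from 0 the function is locally 0 or a power. At 0 its difference quotient is
    [Num.max 0 y ^+ n.+1], which is continuous and vanishes there, as long as the exponent is at
    least 2. *)
Lemma der_pos_exp n x :
  is_derive x 1 (fun y : R => Num.max 0 y ^+ n.+2) (n.+2%:R * Num.max 0 x ^+ n.+1).
Proof.
have [x0|x0|->] := ltgtP x 0.
- apply: (@near_eq_is_derive _ _ _ (fun=> 0)).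
    near=> y; rewrite /= max_l ?expr0n//; apply: ltW; near: y; exact: lt_nbhsl.
  by rewrite expr0n mulr0; exact: der_cst.
- apply: (@near_eq_is_derive _ _ _ (fun y : R => y ^+ n.+2)).
    near=> y; rewrite /= max_r//; apply: ltW; near: y; exact: lt_nbhsr.
  by apply: (is_derive_eq (derX n.+1 (is_derive_id x 1))); rewrite mulr1.
- apply/is_derive1_caratheodory; exists (fun y => Num.max 0 y ^+ n.+1).
  rewrite maxxx !expr0n/= mulr0; split => //.
  + move=> z; rewrite !subr0 exprS mulrC.
    by have [z0|z0] := leP z 0; rewrite ?expr0n ?mul0r.
  + have cm : {for (0 : R), continuous (fun y : R => Num.max 0 y)}.
      by apply: (@continuous_max _ _ (fun=> 0) id); [exact: cvg_cst|exact: cvg_id].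
    exact: (continuous_comp cm (@exprn_continuous R n.+1 _)).
Unshelve. all: by end_near. Qed.

Lemma integral_derivative_eq0 (H h : R -> R) (L : R) :
  (forall b, is_derive b 1 H (h b)) -> continuous h ->
  (forall b, L <= `|b| -> H b = 0) -> (forall b, L <= `|b| -> h b = 0) ->
  (\int[lebesgue_measure]_b (h b)%:E = 0)%E.
Proof.
move=> dH ch H0 h0; pose K : R := `|L| + 1.
have KL : L <= K by rewrite (le_trans (ler_norm _))// lerDl.
have K0 : 0 < K by rewrite ltr_wpDl.
have cH : continuous H by move=> x; exact: der_continuous (dH x).
have -> : (\int[lebesgue_measure]_b (h b)%:E = \int[lebesgue_measure]_(b in `[(- K)%R, K]) (h b)%:E)%E.
  rewrite [RHS]integral_mkcond; apply: eq_integral => b _.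
  rewrite patchE; case: ifPn => //; rewrite notin_setE/= in_itv/= => /negP bK.
  rewrite h0// leNgt; apply: contra bK => bL.
  by have := lt_le_trans bL KL; rewrite ltr_norml => /andP[/ltW -> /ltW ->].
rewrite (@continuous_FTC2 _ h H)//.
- by rewrite !H0 ?normrN ?gtr0_norm// subee.
- by rewrite -subr_gt0 opprK addr_gt0.
- exact: continuous_subspaceT.
- split; last 2 first.
  + by apply: cvg_at_right_filter; exact: cH.
  + by apply: cvg_at_left_filter; exact: cH.
  + by move=> x _; have [] := dH x.
- by move=> x _; rewrite derive1E; have [_ ->] := dH x.
Qed.

End calculus.

(** * Functions with a Gaussian bound and their integrals along lines *)

Section lines.
Context {R : realType}.

(** A Gaussian majorant stands in for compact support: it gives integrability, and by [heat_rcons0]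
    it passes to slices. *)
Lemma bounded_by_heat n (F : 'rV[R]_n -> R) (z : 'rV[R]_n) (L : R) :
  continuous F -> (forall x, L <= sqn (x - z) -> F x = 0) ->
  exists2 C, 0 <= C & forall x, `|F x| <= C * heat 1 z x.
Proof.
(* K >= 1 gives K <= K^2, so the ball [sqn (x - z) < L] lies in the cube of half-side K without a
   square root. *)
move=> cF F0; pose K : R := `|L| + 1.
have KL : L <= K by rewrite (le_trans (ler_norm _))// lerDl.
have K1 : 1 <= K by rewrite lerDr.
pose A : set 'rV[R]_n := [set x | forall i, `[z ord0 i - K, z ord0 i + K]%classic (x ord0 i)].
have cA : compact A by apply: (@rV_compact R n (fun i => `[z ord0 i - K, z ord0 i + K]%classic)) => i; exact: segment_compact.
have : compact (F @` A) by apply: continuous_compact => //; exact: continuous_subspaceT.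
move=> /compact_bounded[B [_ /(_ (`|B| + 1))]].
rewrite (le_lt_trans (ler_norm _)) ?ltrDl// => /(_ isT) FB.
have xA x : ~ A x -> F x = 0.
  move=> nA; apply: F0; rewrite leNgt; apply/negP => xL; apply: nA => i /=.
  have : (x ord0 i - z ord0 i) ^+ 2 <= sqn (x - z).
    by rewrite /sqn (bigD1 i)//= !mxE lerDl sumr_ge0// => j _; rewrite sqr_ge0.
  rewrite in_itv/=; set d := _ - _ => dq; have dK : `|d| <= K.
    have : d ^+ 2 <= K ^+ 2 by rewrite (le_trans dq)// ltW// (lt_le_trans xL)// (le_trans KL)// expr2 ler_peMl// (le_trans _ K1).
    by rewrite -[d ^+ 2]real_normK ?num_real// ler_sqr// nnegrE ltW// (lt_le_trans ltr01).
  by move: dK; rewrite ler_norml /d => /andP[? ?]; lra.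
(* The value of the kernel at squared distance K, a lower bound for it on the support of F. *)
pose c := (Num.sqrt (4 * pi * 1))^-1 ^+ n * expR (- K / (4 * 1)) : R.
have c0 : 0 < c.
  by rewrite mulr_gt0 ?expR_gt0// exprn_gt0// invr_gt0 sqrtr_gt0 !mulr_gt0 ?pi_gt0.
exists ((`|B| + 1) / c) => [|x].
  by rewrite divr_ge0 ?(ltW c0)// addr_ge0.
have [xL|xL] := leP L (sqn (x - z)).
  by rewrite F0// normr0 mulr_ge0 ?heat_ge0// divr_ge0 ?(ltW c0)// addr_ge0.
have FxB : `|F x| <= `|B| + 1.
  have [Ax|/xA ->] := pselect (A x); first by apply: FB; exists x.
  by rewrite normr0 addr_ge0.
rewrite (le_trans FxB)// -mulrA ler_peMr ?addr_ge0// mulrC ler_pdivlMr// mul1r.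
rewrite /c /heat ler_wpM2l ?exprn_ge0 ?invr_ge0 ?sqrtr_ge0// ler_expR.
rewrite ler_pM2r ?invr_gt0// lerN2 ltW// (lt_le_trans xL)//.
Qed.

Lemma integrable_le_heat n (F : 'rV[R]_n -> R) (z : 'rV[R]_n) (C s : R) :
  0 < s -> measurable_fun setT F -> (forall x, `|F x| <= C * heat s z x) ->
  (rVmeas n).-integrable setT (EFin \o F).
Proof.
move=> s0 mF FC.
apply: (@le_integrable _ _ _ _ _ _ _ (fun x => C%:E * (heat s z x)%:E)%E) => //.
- exact/measurable_EFinP.
- move=> x _ /=; rewrite lee_fin (le_trans (FC x))// normrM (ger0_norm (heat_ge0 _ _ _)).
  by rewrite ler_wpM2r ?heat_ge0// ler_norm.
- by apply: integrableZl => //; exact: integrable_heat.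
Qed.

Lemma rcons0_lineS n a (x : 'rV[R]_n) (b : R) j :
  rcons0 (a, x) + b *: delta_mx ord0 (lift ord0 j) = rcons0 (a, x + b *: delta_mx ord0 j).
Proof.
apply/rowP => k; rewrite [RHS]rcons0E [LHS]mxE rcons0E [X in _ + X]mxE [X in _ * X]mxE.
case: (unliftP ord0 k) => [l|] -> /=; last by rewrite mulr0 addr0.
by rewrite !mxE (inj_eq lift_inj).
Qed.

Lemma rcons0_line0 n (a : R) (x : 'rV[R]_n) (b : R) :
  rcons0 (a, x) + b *: delta_mx ord0 ord0 = rcons0 (a + b, x).
Proof.
apply/rowP => k; rewrite [RHS]rcons0E [LHS]mxE rcons0E [X in _ + X]mxE [X in _ * X]mxE.
by case: (unliftP ord0 k) => [l|] -> /=; rewrite ?mulr1// mulr0 addr0.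
Qed.

(** Fubini, integrating first along the i-th axis. If that is the first axis the inner integrals
    vanish at once; otherwise the first coordinate is frozen, and the Gaussian hypothesis survives
    with C multiplied by a normal density. *)
Lemma integral_lines_eq0 n (F : 'rV[R]_n -> R) (z : 'rV[R]_n) (C : R) (i : 'I_n) :
  continuous F -> (forall x, `|F x| <= C * heat 1 z x) ->
  (forall x, \int[lebesgue_measure]_b (F (x + b *: delta_mx ord0 i))%:E = 0)%E ->
  (\int[rVmeas n]_x (F x)%:E = 0)%E.
Proof.
elim: n F z C i => [|n IH] F z C i cF FC F0; first by case: i F0 => [].
have iF : (rVmeas n.+1).-integrable setT (EFin \o F).
  by apply: (integrable_le_heat _ _ FC) => //; exact: continuous_rV_measurable.
have [F1 F2] := integral_rV_S iF.
case: (unliftP ord0 i) F0 => [j|] -> F0.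
  rewrite [LHS]F1; apply: integral0_eq => a _ /=.
  apply: (IH (fun x => F (rcons0 (a, x))) (uncons z).2
    (C * normal_pdf (z ord0 ord0) (Num.sqrt (2 * 1)) a) j).
  - move=> x; apply: (@cvg_comp _ _ _ (fun y => rcons0 (a, y)) F); last exact: cF.
    exact: continuous_rcons0r.
  - by move=> x; rewrite (le_trans (FC _))// heat_rcons0//= mulrA.
  - move=> x; rewrite -[RHS](F0 (rcons0 (a, x))); apply: eq_integral => b _.
    by rewrite -rcons0_lineS.
rewrite [LHS]F2; apply: integral0_eq => x _ /=.
rewrite -[RHS](F0 (rcons0 (0, x))); apply: eq_integral => b _.
by rewrite rcons0_line0 add0r.
Qed.

End lines.

(** * The heat kernel with a cutoff *)

Section cutoff.
Context {R : realType} (n : nat).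
Implicit Types (s k q : R).

Definition heat_norm s : R := (Num.sqrt (4 * pi * s))^-1 ^+ n.
Definition heat_fun s q : R := heat_norm s * expR (- q / (4 * s)).
Definition pos k q : R := Num.max 0 (1 - k * q).

(* The heat kernel cut off at [q = 1 / k], as a function of the squared
   distance [q], with its first two derivatives in [q]. *)
Definition cut s k q : R := heat_fun s q * pos k q ^+ 3.
Definition cut1 s k q : R :=
  heat_fun s q * (- (4 * s)^-1 * pos k q ^+ 3 - 3 * k * pos k q ^+ 2).
Definition cut2 s k q : R :=
  heat_fun s q * ((4 * s)^-1 ^+ 2 * pos k q ^+ 3 + (4 * s)^-1 * 6 * k * pos k q ^+ 2
    + 6 * k ^+ 2 * pos k q).
(* The defect of the cut-off kernel in the heat equation, see [cut_errE] *)
Definition cut_err s k q : R :=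
  heat_fun s q * (6 * q * k * pos k q ^+ 2 / s + 24 * q * k ^+ 2 * pos k q
    - 6 * n%:R * k * pos k q ^+ 2).

Lemma heat_norm_gt0 s : 0 < s -> 0 < heat_norm s.
Proof. by move=> s0; rewrite exprn_gt0// invr_gt0 sqrtr_gt0 !mulr_gt0// pi_gt0. Qed.

Lemma heat_fun_ge0 s q : 0 <= heat_fun s q.
Proof. by rewrite mulr_ge0 ?expR_ge0// exprn_ge0// invr_ge0 sqrtr_ge0. Qed.

Lemma pos_ge0 k q : 0 <= pos k q.
Proof. by rewrite le_max lexx. Qed.

Lemma pos_le1 k q : 0 <= k -> 0 <= q -> pos k q <= 1.
Proof. by move=> k0 q0; rewrite ge_max ler01 gerBl mulr_ge0. Qed.

Lemma cut_ge0 s k q : 0 <= cut s k q.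
Proof. by rewrite mulr_ge0 ?heat_fun_ge0// exprn_ge0// pos_ge0. Qed.

Lemma cut_le s k q : 0 <= k -> 0 <= q -> cut s k q <= heat_fun s q.
Proof.
by move=> k0 q0; rewrite ler_piMr ?heat_fun_ge0// exprn_ile1 ?pos_ge0// pos_le1.
Qed.

Lemma is_derive_pos k q m :
  is_derive q 1 (fun q => pos k q ^+ m.+2) (- k * (m.+2%:R * pos k q ^+ m.+1)).
Proof.
have h : is_derive q 1 (fun q => 1 - k * q) (- k).
  apply: is_derive_eq (derB (der_cst q 1) (derMl k (is_derive_id q 1))) _.
  by rewrite mulr1 add0r.
by apply: (is_derive_eq (der_comp (der_pos_exp m _) h)); rewrite mulrC.
Qed.

Lemma is_derive_heat_fun s q :
  is_derive q 1 (heat_fun s) (- (4 * s)^-1 * heat_fun s q).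
Proof.
have h : is_derive q 1 (fun q => - q / (4 * s)) (- (4 * s)^-1).
  apply: is_derive_eq (derM (derN (is_derive_id q 1)) (der_cst q (4 * s)^-1)) _.
  by rewrite mulr0 add0r mulN1r.
apply: is_derive_eq (derMl (heat_norm s) (der_exp h)) _.
by rewrite mulrA mulrC.
Qed.

Lemma is_derive_cut s k q : is_derive q 1 (cut s k) (cut1 s k q).
Proof.
apply: is_derive_eq (derM (is_derive_heat_fun s q) (is_derive_pos k q 1)) _.
by rewrite /cut1; ring.
Qed.

(* At the kink [k q = 1] the first power of [pos] is not differentiable, but
   [cut1] only involves its second and third powers. *)
Lemma is_derive_cut1 s k q : is_derive q 1 (cut1 s k) (cut2 s k q).
Proof.
apply: is_derive_eq (derM (is_derive_heat_fun s q)
  (derB (derMl (- (4 * s)^-1) (is_derive_pos k q 1))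
    (derMl (3 * k) (is_derive_pos k q 0)))) _.
by rewrite /cut2 !expr1; ring.
Qed.

Lemma is_derive_cut_s s k q : 0 < s ->
  is_derive s 1 (fun s => cut s k q)
    (cut s k q * (- n%:R / (2 * s) + q / (4 * s ^+ 2))).
Proof.
move=> s0.
have s40 : 0 < 4 * pi * s by rewrite !mulr_gt0 ?pi_gt0.
have dl : is_derive s 1 (fun s => - (n%:R / 2) * ln (4 * pi * s)) (- (n%:R / 2) * s^-1).
  apply: is_derive_eq (derMl _ (der_comp (is_derive1_ln s40) (derMl (4 * pi) (is_derive_id s 1)))) _.
  by move: (pi : R) (pi_gt0 R) => p p0; field; rewrite !gt_eqF.
have dq : is_derive s 1 (fun s => - q / (4 * s)) (q / (4 * s ^+ 2)).
  have h : is_derive s 1 (fun s => 4 * s) 4.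
    by apply: is_derive_eq (derMl 4 (is_derive_id s 1)) _; rewrite mulr1.
  have s4 : 4 * s != 0 by rewrite mulf_neq0 ?gt_eqF.
  apply: is_derive_eq (derMl (- q) (is_deriveV s4 h)) _.
  by rewrite /GRing.scale/=; field; rewrite gt_eqF.
have d := derM (der_exp (derD dl dq)) (der_cst s (pos k q ^+ 3)).
(* As an exponential, the normalisation is differentiated together with the Gaussian factor. The
   identity needs t > 0, so it is used only near s. *)
have normE t : 0 < t -> heat_norm t = expR (- (n%:R / 2) * ln (4 * pi * t)).
  move=> t0; have t40 : 0 < 4 * pi * t by rewrite !mulr_gt0 ?pi_gt0.
  rewrite /heat_norm -[X in Num.sqrt X]lnK// -[in LHS](powR12_sqrt (expR_ge0 _)).
  by rewrite -powRN -expRM -powR_mulrn ?powR_ge0// -expRM; congr expR; field.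
apply: near_eq_is_derive; last first.
  apply: (is_derive_eq d); rewrite mulr0 add0r expRD -(normE _ s0).
  by rewrite /cut /heat_fun; field; rewrite gt_eqF.
near=> t; have t0 : 0 < t by near: t; exact: lt_nbhsr.
by rewrite /= expRD -normE.
Unshelve. all: by end_near. Qed.

(** The Laplacian of phi(|x - z|^2) is 4 q phi'' + 2 n phi'. The uncut kernel solves the heat
    equation, so only the terms in which the cutoff is differentiated remain, and each carries a
    factor k. *)
Lemma cut_errE s k q : s != 0 ->
  4 * q * cut2 s k q + 2 * n%:R * cut1 s k q
    - cut s k q * (- n%:R / (2 * s) + q / (4 * s ^+ 2)) = cut_err s k q.
Proof. by move=> s0; rewrite /cut2 /cut1 /cut /cut_err; field. Qed.

Lemma cut_eq0 s k q : 1 <= k * q -> [/\ cut s k q = 0, cut1 s k q = 0 & cut2 s k q = 0].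
Proof.
move=> kq; have p0 : pos k q = 0 by apply: max_l; rewrite subr_le0.
by rewrite /cut /cut1 /cut2 p0 !expr0n/= !(mulr0, subr0, addr0).
Qed.

Lemma cut_err_le s k q : 0 < s -> 0 <= k -> 0 <= q ->
  `|cut_err s k q| <= k * heat_fun s q * (6 * q / s + (24 + 6 * n%:R)).
Proof.
move=> s0 k0 q0; rewrite normrM ger0_norm ?heat_fun_ge0// [leRHS]mulrAC [leRHS]mulrC.
apply: ler_wpM2l; first exact: heat_fun_ge0.
have p0 := pos_ge0 k q; have p1 := pos_le1 k0 q0.
have p2 : pos k q ^+ 2 <= 1 by rewrite exprn_ile1.
have p20 : 0 <= pos k q ^+ 2 by exact: sqr_ge0.
(* The cutoff vanishes once k q >= 1; this turns the term of order k^2 q into one of order k. *)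
have kqp : k * q * pos k q <= 1.
  rewrite /pos; have [kq|kq] := leP (k * q) 1.
    by rewrite mulr_ile1 ?mulr_ge0.
  by rewrite max_l ?subr_le0 ?(ltW kq)// mulr0.
rewrite (le_trans (ler_normB _ _))//.
rewrite !ger0_norm; last 2 first.
- by rewrite !mulr_ge0.
- by rewrite addr_ge0 ?mulr_ge0 ?sqr_ge0 ?invr_ge0 ?(ltW s0).
rewrite mulrDr mulrDr addrA lerD//; first rewrite lerD//.
- rewrite (_ : 6 * q * k * pos k q ^+ 2 / s = k * (6 * q / s) * pos k q ^+ 2); last by ring.
  by rewrite ler_piMr// !mulr_ge0// invr_ge0 ltW.
- rewrite (_ : _ * pos k q = k * 24 * (k * q * pos k q)); last by ring.
  by rewrite ler_piMr// mulr_ge0.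
- rewrite (_ : _ * pos k q ^+ 2 = k * (6 * n%:R) * pos k q ^+ 2); last by ring.
  by rewrite ler_piMr// !mulr_ge0.
Qed.

Lemma cut_near s k q : 0 <= k -> 0 <= q ->
  `|cut s k q - heat_fun s q| <= 3 * k * (q * heat_fun s q).
Proof.
move=> k0 q0; rewrite distrC ger0_norm ?subr_ge0 ?cut_le//.
rewrite /cut -{1}[heat_fun s q]mulr1 -mulrBr mulrA [leRHS]mulrC.
apply: ler_wpM2l; first exact: heat_fun_ge0.
have kq0 : 0 <= k * q by rewrite mulr_ge0.
have := pos_ge0 k q; have : 1 - k * q <= pos k q by rewrite le_max lexx orbT.
move: (pos k q) => p pk p0.
(* The tangent bound 1 - p^3 <= 3 (1 - p), in the form 2 - 3p + p^3 = (1 - p)^2 (2 + p) >= 0,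
   together with 1 - p <= k q. *)
have : 0 <= (1 - p) ^+ 2 * (2 + p) by rewrite mulr_ge0 ?sqr_ge0// addr_ge0.
have -> : (1 - p) ^+ 2 * (2 + p) = 2 - 3 * p + p ^+ 3 by ring.
by lra.
Qed.

End cutoff.

(** * Gaussian domination and Green's formula along the axes *)

Section heat_domination.
Context {R : realType} (n : nat) (z : 'rV[R]_n).

Lemma heatE s x : heat s z x = heat_fun n s (sqn (x - z)).
Proof. by []. Qed.

Lemma Rintegral_heat s : 0 < s -> \int[rVmeas n]_x heat s z x = 1.
Proof. by move=> s0; rewrite /Rintegral integral_heat. Qed.

(** The error terms below are at most (a + b q) times a kernel. [sqn_heat_le] trades the factor q
    for a kernel of doubled time, so two kernels suffice, and since each has mass 1 the integral is
    at most the sum of the coefficients. *)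
Lemma le_heat2 (F : 'rV[R]_n -> R) (a b s t : R) :
  0 < s -> 0 < t -> measurable_fun setT F ->
  (forall x, `|F x| <= a * heat s z x + b * heat t z x) ->
  (rVmeas n).-integrable setT (EFin \o F) /\ `|\int[rVmeas n]_x F x| <= a + b.
Proof.
move=> s0 t0 mF Fab.
have ha c r : 0 < r -> (rVmeas n).-integrable setT (EFin \o (fun x => c * heat r z x)).
  by move=> r0; exact: (integrableZl measurableT c (integrable_heat z r0)).
have hab : (rVmeas n).-integrable setT (EFin \o (fun x => a * heat s z x + b * heat t z x)).
  exact: (integrableD measurableT (ha a _ s0) (ha b _ t0)).
have iF : (rVmeas n).-integrable setT (EFin \o F).
  apply: le_integrable hab => //; first exact/measurable_EFinP.
  by move=> x _ /=; rewrite lee_fin (le_trans (Fab x))// ler_norm.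
split => //; rewrite (le_trans (le_normr_Rintegral _ iF))//.
apply: (@le_trans _ _ (\int[rVmeas n]_x (a * heat s z x + b * heat t z x))).
  by apply: le_Rintegral => //; exact: integrable_norm.
rewrite (RintegralD measurableT (ha a _ s0) (ha b _ t0)).
rewrite (RintegralZl a measurableT (integrable_heat z s0)).
by rewrite (RintegralZl b measurableT (integrable_heat z t0)) !Rintegral_heat// !mulr1.
Qed.

Lemma sqn_line (x : 'rV[R]_n) (i : 'I_n) b :
  sqn (x + b *: delta_mx ord0 i - z) =
  sqn (x - z) + 2 * b * (x ord0 i - z ord0 i) + b ^+ 2.
Proof.
rewrite /sqn (bigD1 i)//= [in RHS](bigD1 i)//= !mxE !eqxx mulr1.
rewrite (eq_bigr (fun j => (x - z) ord0 j ^+ 2)); last first.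
  by move=> j ji; rewrite !mxE (negbTE ji) andbF mulr0 addr0.
ring.
Qed.

Lemma is_derive_sqn_line (x : 'rV[R]_n) (i : 'I_n) (b : R) :
  is_derive b 1 (fun b => sqn (x + b *: delta_mx ord0 i - z))
    (2 * ((x + b *: delta_mx ord0 i) ord0 i - z ord0 i)).
Proof.
under eq_fun do rewrite sqn_line.
have d1 := derM (derMl 2 (is_derive_id b 1)) (der_cst b (x ord0 i - z ord0 i)).
have d2 := derX 1 (is_derive_id b (1 : R)).
apply: is_derive_eq (derD (derD (der_cst b (sqn (x - z))) d1) d2) _.
by rewrite !mxE !eqxx /=; ring.
Qed.

Lemma continuous_pos k : continuous (@pos R k).
Proof.
move=> q; apply: (@continuous_max _ _ (fun=> 0) (fun q => 1 - k * q)); first exact: cvg_cst.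
by apply: cvgB; [exact: cvg_cst|apply: cvgM; [exact: cvg_cst|exact: cvg_id]].
Qed.

Lemma continuous_cut2 (s k : R) : continuous (cut2 n s k).
Proof.
have cp m : continuous (fun q : R => pos k q ^+ m).
  by move=> q; exact: (continuous_comp (@continuous_pos k q) (@exprn_continuous R m _)).
move=> q; apply: cvgM; first exact: der_continuous (is_derive_heat_fun n s q).
apply: cvgD; first apply: cvgD; apply: cvgM; (exact: cvg_cst || exact: cp || exact: continuous_pos).
Qed.

(* Second derivative of [cut n s k (sqn (x - z))] along the [i]-th axis *)
Definition box_cut s k (i : 'I_n) (x : 'rV[R]_n) : R :=
  cut2 n s k (sqn (x - z)) * (2 * (x ord0 i - z ord0 i)) ^+ 2 + 2 * cut1 n s k (sqn (x - z)).

Lemma continuous_comp_sqn (f : R -> R) :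
  continuous f -> continuous (fun x : 'rV[R]_n => f (sqn (x - z))).
Proof.
move=> cf x; apply: (@cvg_comp _ _ _ (fun y => sqn (y - z)) f); last exact: cf.
exact: continuous_sqn.
Qed.

Lemma continuous_cut_sqn (s k : R) : continuous (fun x : 'rV[R]_n => cut n s k (sqn (x - z))).
Proof. by apply: continuous_comp_sqn => q; exact: der_continuous (is_derive_cut n s k q). Qed.

Lemma continuous_box_cut s k i : continuous (box_cut s k i).
Proof.
move=> x; apply: (@cvgD _ _ _ (nbhs x)); apply: (@cvgM _ _ (nbhs x)).
- by apply: continuous_comp_sqn; exact: continuous_cut2.
- apply: (@cvg_comp _ _ _ (fun y : 'rV[R]_n => 2 * (y ord0 i - z ord0 i)) (fun r => r ^+ 2)); last exact: exprn_continuous.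
  apply: (@cvgM _ _ (nbhs x)); first exact: cvg_cst.
  by apply: (@cvgB _ _ _ (nbhs x)); [exact: coord_continuous|exact: cvg_cst].
- exact: cvg_cst.
- by apply: continuous_comp_sqn => q; exact: der_continuous (is_derive_cut1 n s k q).
Qed.

(** On each line F is the derivative of g' c - g c', with c the cut-off kernel. This vanishes
    outside the support of c, whatever the growth of g and g'. *)
Lemma integral_green (g g1 g2 : 'rV[R]_n -> R) (s k : R) (i : 'I_n) :
  0 < k ->
  continuous g -> continuous g2 ->
  (forall x (b : R), is_derive b 1 (fun b => g (x + b *: delta_mx ord0 i)) (g1 (x + b *: delta_mx ord0 i))) ->
  (forall x (b : R), is_derive b 1 (fun b => g1 (x + b *: delta_mx ord0 i)) (g2 (x + b *: delta_mx ord0 i))) ->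
  let F x := g2 x * cut n s k (sqn (x - z)) - g x * box_cut s k i x in
  (rVmeas n).-integrable setT (EFin \o F) /\ \int[rVmeas n]_x F x = 0.
Proof.
move=> k0 cg cg2 dg dg1 F.
have cF : continuous F.
  move=> x; apply: (@cvgB _ _ _ (nbhs x)); apply: (@cvgM _ _ (nbhs x)).
  - exact: cg2.
  - exact: continuous_cut_sqn.
  - exact: cg.
  - exact: continuous_box_cut.
have kq q : k^-1 <= q -> 1 <= k * q by move=> h; rewrite -(ler_pM2l k0) mulfV ?gt_eqF in h.
have F0 x : k^-1 <= sqn (x - z) -> F x = 0.
  move=> /kq/(cut_eq0 n s)[c c1 c2].
  by rewrite /F /box_cut c c1 c2 !(mulr0, mul0r) addr0 mulr0 subrr.
have [C C0 FC] := bounded_by_heat cF F0.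
split; first by apply: (integrable_le_heat _ _ FC) => //; exact: continuous_rV_measurable.
rewrite /Rintegral (integral_lines_eq0 (i := i) cF FC)// => x.
pose q b := sqn (x + b *: delta_mx ord0 i - z).
pose l b := x + b *: delta_mx ord0 i.
pose H b := g1 (l b) * cut n s k (q b) - g (l b) * (cut1 n s k (q b) * (2 * (l b ord0 i - z ord0 i))).
have cl : continuous l.
  move=> b; apply: continuous_rVP => j; rewrite !mxE.
  under eq_fun do rewrite !mxE.
  by apply: cvgD; [exact: cvg_cst|apply: cvgM; [exact: cvg_id|exact: cvg_cst]].
(* For |b| >= L the i-th coordinate of the point differs from that of z by at least 1 + 1/k, and (1
   + 1/k)^2 >= 1/k. *)
pose L := `|x ord0 i - z ord0 i| + (1 + k^-1).
have qL b : L <= `|b| -> k^-1 <= q b.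
  move=> Lb; have ki : 0 < k^-1 by rewrite invr_gt0.
  have : (l b ord0 i - z ord0 i) ^+ 2 <= q b.
    by rewrite /q /sqn (bigD1 i)//= !mxE lerDl sumr_ge0// => j _; rewrite sqr_ge0.
  apply: le_trans.
  have bl : `|b| - `|x ord0 i - z ord0 i| <= `|l b ord0 i - z ord0 i|.
    rewrite !mxE !eqxx mulr1 lerBlDr.
    have e : b = (x ord0 i + b - z ord0 i) - (x ord0 i - z ord0 i) by ring.
    by rewrite {1}e ler_normB.
  have h : 1 + k^-1 <= `|l b ord0 i - z ord0 i| by rewrite (le_trans _ bl)// lerBrDl.
  rewrite -real_normK ?num_real//; move: (`|_ - _|) h => d h.
  by nra.
apply: (@integral_derivative_eq0 _ H (fun b => F (l b)) L).
- move=> b; have dq := is_derive_sqn_line x i b.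
  have dlin : is_derive b 1 (fun b => 2 * (l b ord0 i - z ord0 i)) 2.
    rewrite /l; under eq_fun do rewrite !mxE !eqxx mulr1.
    have dd := derB (derD (der_cst b (x ord0 i)) (is_derive_id b 1)) (der_cst b (z ord0 i)).
    by apply: is_derive_eq (derMl 2 dd) _; rewrite add0r subr0 mulr1.
  have dc : is_derive b 1 (fun b => cut n s k (q b)) _ := der_comp (is_derive_cut n s k (q b)) dq.
  have dc1 : is_derive b 1 (fun b => cut1 n s k (q b)) _ := der_comp (is_derive_cut1 n s k (q b)) dq.
  apply: is_derive_eq (derB (derM (dg1 x b) dc) (derM (dg x b) (derM dc1 dlin))) _.
  rewrite /F /box_cut -/(l b) -/(q b); ring.
- by move=> b; exact: (continuous_comp (cl b) (cF (l b))).
- move=> b /qL/kq/(cut_eq0 n s)[c c1 c2].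
  by rewrite /H c c1 !(mulr0, mul0r) subrr.
- by move=> b /qL/F0.
Qed.

End heat_domination.

(** * Representation of bounded solutions *)

Section representation.
Context {R : realType} (n : nat).
Implicit Types (s t k T d e : R) (x : 'rV[R]_n).
Variables (u ut : 'rV[R]_n -> R -> R) (u1 u2 : 'I_n -> 'rV[R]_n -> R -> R) (M M1 : R).
Hypothesis dut : forall x (s : R), 0 < s -> is_derive s 1 (u x) (ut x s).
Hypothesis du1 : forall i x (s b : R), 0 < s ->
  is_derive b 1 (fun b => u (x + b *: delta_mx ord0 i) s) (u1 i (x + b *: delta_mx ord0 i) s).
Hypothesis du2 : forall i x (s b : R), 0 < s ->
  is_derive b 1 (fun b => u1 i (x + b *: delta_mx ord0 i) s) (u2 i (x + b *: delta_mx ord0 i) s).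
Hypothesis cu : forall s, 0 <= s -> continuous (u ^~ s).
Hypothesis cu2 : forall i s, 0 < s -> continuous (u2 i ^~ s).
Hypothesis cut0 : forall x, u x s @[s --> 0^'+] --> u x 0.
Hypothesis heat_eq : forall x s, 0 < s -> ut x s = \sum_(i < n) u2 i x s.
Hypothesis uM : forall x s, 0 <= s -> `|u x s| <= M.
Hypothesis utM : forall x s, 0 < s -> `|ut x s| <= M1.
Variable z : 'rV[R]_n.

Let theta (s t : R) : R := \int[rVmeas n]_x (u x s * heat t z x).
Let psi (k T s : R) : R := \int[rVmeas n]_x (u x s * cut n (T - s) k (sqn (x - z))).

Let M0 : 0 <= M.
Proof. by apply: le_trans (uM 0 (lexx 0)). Qed.
Let M10 : 0 <= M1.
Proof. by apply: le_trans (utM 0 (ltr01 : 0 < 1 :> R)). Qed.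

Let sqn_cont_mul (f : R -> R) s : 0 <= s -> continuous f ->
  measurable_fun setT (fun x => u x s * f (sqn (x - z))).
Proof.
move=> s0 cf; apply: continuous_rV_measurable => x; apply: (@cvgM _ _ (nbhs x)).
  exact: cu.
by apply: continuous_comp_sqn.
Qed.

Let continuous_heat_fun t : continuous (heat_fun n t : R -> R).
Proof. by move=> q; exact: der_continuous (is_derive_heat_fun n t q). Qed.

Let integrable_theta s t : 0 <= s -> 0 < t ->
  (rVmeas n).-integrable setT (EFin \o (fun x => u x s * heat t z x)).
Proof.
move=> s0 t0; apply: (@integrable_le_heat _ _ _ z M t) => //.
  exact: (sqn_cont_mul s0 (@continuous_heat_fun t)).
by move=> x; rewrite normrM (ger0_norm (heat_ge0 _ _ _)) ler_wpM2r ?heat_ge0// uM.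
Qed.

Let integrable_psi k s t : 0 <= s -> 0 < t -> 0 <= k ->
  (rVmeas n).-integrable setT (EFin \o (fun x => u x s * cut n t k (sqn (x - z)))).
Proof.
move=> s0 t0 k0; apply: (@integrable_le_heat _ _ _ z M t) => //.
  by apply: (sqn_cont_mul s0) => q; exact: der_continuous (is_derive_cut n t k q).
move=> x; rewrite normrM (ger0_norm (cut_ge0 _ _ _ _)) ler_pM ?uM ?cut_ge0//.
by rewrite heatE cut_le// sqn_ge0.
Qed.

Let psi_near_theta k s t : 0 <= s -> 0 < t -> 0 <= k ->
  `|psi k (s + t) s - theta s t| <= 3 * k * M * (8 * t * Num.sqrt 2 ^+ n).
Proof.
move=> s0 t0 k0; rewrite /psi /theta (_ : s + t - s = t); last by ring.
rewrite -RintegralB//; [|exact: integrable_psi|exact: integrable_theta].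
have [||_] := @le_heat2 _ _ z
  (fun x => u x s * cut n t k (sqn (x - z)) - u x s * heat t z x)
  0 (3 * k * M * (8 * t * Num.sqrt 2 ^+ n)) t (2 * t) t0 (mulr_gt0 (ltr0Sn R 1) t0).
- apply: measurable_funB.
    by apply: (sqn_cont_mul s0) => q; exact: der_continuous (is_derive_cut n t k q).
  exact: (sqn_cont_mul s0 (@continuous_heat_fun t)).
- move=> x; rewrite mul0r add0r -mulrBr normrM.
  apply: (@le_trans _ _ (M * (3 * k * (sqn (x - z) * heat t z x)))).
    by rewrite ler_pM ?uM// heatE cut_near// sqn_ge0.
  rewrite [leLHS](_ : _ = 3 * k * M * (sqn (x - z) * heat t z x)); last by ring.
  by rewrite -[leRHS]mulrA ler_wpM2l ?sqn_heat_le// !mulr_ge0.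
by rewrite add0r.
Qed.

Let dpsi (k T s : R) x : R :=
  ut x s * cut n (T - s) k (sqn (x - z))
  - u x s * (cut n (T - s) k (sqn (x - z))
    * (- n%:R / (2 * (T - s)) + sqn (x - z) / (4 * (T - s) ^+ 2))).

Let is_derive_psi_integrand k T s x : 0 < s < T ->
  is_derive s 1 (fun s => u x s * cut n (T - s) k (sqn (x - z))) (dpsi k T s x).
Proof.
move=> /andP[s0 sT]; have dT : is_derive s 1 (fun s => T - s) (-1).
  by apply: is_derive_eq (derB (der_cst s T) (is_derive_id s 1)) _; rewrite sub0r.
have Ts : 0 < T - s by rewrite subr_gt0.
have dc : is_derive s 1 (fun s => cut n (T - s) k (sqn (x - z))) _ :=
  @der_comp _ (fun t => cut n t k (sqn (x - z))) (fun s => T - s) _ _ _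
    (is_derive_cut_s n k (sqn (x - z)) Ts) dT.
apply: (is_derive_eq (derM (dut x s0) dc)).
by rewrite /dpsi; ring.
Qed.

(** One majorant for all times in [d, T]: the exponential increases with the time and is largest at
    T, the normalisation decreases and is largest at d. *)
Let heat_fun_le (d t T q : R) : 0 < d -> d <= t <= T -> 0 <= q ->
  heat_fun n t q <= heat_norm n d / heat_norm n T * heat_fun n T q.
Proof.
move=> d0 /andP[dt tT] q0; have t0 : 0 < t by exact: lt_le_trans dt.
have T0 : 0 < T by exact: lt_le_trans tT.
rewrite /heat_fun mulrA divfK ?gt_eqF ?heat_norm_gt0//.
apply: ler_pM; first exact/ltW/heat_norm_gt0; first exact: expR_ge0.
  rewrite /heat_norm lerXn2r ?nnegrE ?invr_ge0 ?sqrtr_ge0// lef_pV2 ?posrE ?sqrtr_gt0 ?mulr_gt0 ?pi_gt0//.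
  by rewrite ler_wsqrtr// ler_pM2l ?mulr_gt0 ?pi_gt0.
rewrite ler_expR !mulNr lerN2 ler_wpM2l// lef_pV2 ?posrE ?mulr_gt0//.
by rewrite ler_pM2l.
Qed.

(** The bound does not depend on s in (d, T - d): it is the integrable majorant for differentiating
    [psi] under the integral. *)
Let dpsi_le (d k T s : R) x : 0 < d -> d < s < T - d -> 0 <= k ->
  `|dpsi k T s x| <= heat_norm n d / heat_norm n T *
    ((M1 + M * (n%:R / (2 * d))) * heat T z x
     + M / (4 * d ^+ 2) * (8 * T * Num.sqrt 2 ^+ n) * heat (2 * T) z x).
Proof.
move=> d0 /andP[ds sTd] k0; set q := sqn (x - z); set t := T - s.
have q0 : 0 <= q by exact: sqn_ge0.
have dt : d < t by rewrite /t; lra.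
have t0 : 0 < t by exact: lt_trans dt.
have tT : t <= T by rewrite /t; lra.
have T0 : 0 < T by exact: lt_le_trans tT.
have s0 : 0 < s by exact: lt_trans ds.
have c0 : 0 <= heat_norm n d / heat_norm n T by rewrite divr_ge0 ?ltW ?heat_norm_gt0.
have h1 : cut n t k q <= heat_norm n d / heat_norm n T * heat T z x.
  by rewrite (le_trans (cut_le _ _ k0 q0))// heatE heat_fun_le// (ltW dt) tT.
have h2 : `|- n%:R / (2 * t) + q / (4 * t ^+ 2)| <= n%:R / (2 * d) + q / (4 * d ^+ 2).
  rewrite (le_trans (ler_normD _ _))// mulNr normrN !ger0_norm; last 2 first.
  - by rewrite divr_ge0// mulr_ge0// sqr_ge0.
  - by rewrite divr_ge0// mulr_ge0// ltW.
  apply: lerD; rewrite ler_wpM2l// lef_pV2 ?posrE ?mulr_gt0 ?exprn_gt0// ler_pM2l//.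
    exact: ltW.
  by rewrite lerXn2r ?nnegrE ?ltW.
apply: (@le_trans _ _ ((M1 + M * (n%:R / (2 * d) + q / (4 * d ^+ 2))) * cut n t k q)).
  rewrite /dpsi -/t -/q (le_trans (ler_normB _ _))//.
  rewrite (normrM (ut x s)) (normrM (u x s)) (normrM (cut _ _ _ _)) !(ger0_norm (cut_ge0 _ _ _ _)).
  rewrite [leRHS]mulrDl lerD//; first by rewrite ler_wpM2r ?cut_ge0// utM.
  rewrite [X in _ * X]mulrC mulrA ler_wpM2r ?cut_ge0// ler_pM ?uM//; exact: ltW.
have A0 : 0 <= M1 + M * (n%:R / (2 * d) + q / (4 * d ^+ 2)).
  by rewrite addr_ge0// mulr_ge0// addr_ge0// divr_ge0// mulr_ge0// ?sqr_ge0 ?ltW.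
rewrite (le_trans (ler_wpM2l A0 h1))// mulrCA ler_wpM2l//.
rewrite [X in X * _ <= _](_ : _ = (M1 + M * (n%:R / (2 * d))) + M / (4 * d ^+ 2) * q); last by ring.
rewrite mulrDl lerD2l -[leLHS]mulrA -[leRHS]mulrA ler_wpM2l ?sqn_heat_le//.
by rewrite divr_ge0 ?mulr_ge0 ?(ltW d0).
Qed.

(** Green's formula leaves only [u] times the defect. In the constant, 48 is 6/t from [cut_err_le]
    times 8t from [sqn_heat_le]: the time cancels, so the bound is uniform on (0, T) and of order
    k. *)
Let integral_dpsi (k T s : R) : 0 < k -> 0 < s < T ->
  `|\int[rVmeas n]_x dpsi k T s x| <= k * (M * (24 + 6 * n%:R + 48 * Num.sqrt 2 ^+ n)).
Proof.
move=> k0 /andP[s0 sT]; set t := T - s.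
have t0 : 0 < t by rewrite subr_gt0.
pose F (i : 'I_n) x := u2 i x s * cut n t k (sqn (x - z)) - u x s * box_cut z t k i x.
have FP i : (rVmeas n).-integrable setT (EFin \o F i) /\ \int[rVmeas n]_x F i x = 0.
  apply: (@integral_green _ _ z (u ^~ s) (u1 i ^~ s) (u2 i ^~ s) t k i) => //.
  - exact/cu/ltW.
  - exact: cu2.
  - by move=> x b; exact: du1.
  - by move=> x b; exact: du2.
pose E x := u x s * cut_err n t k (sqn (x - z)).
(* The heat equation replaces [ut] by the sum of the [u2 i]; summed over the axes, [box_cut] becomes
   4 q [cut2] + 2 n [cut1], so what is not in Green form is the defect. *)
have dE x : dpsi k T s x = \sum_(i < n) F i x + E x.
  rewrite /dpsi -/t heat_eq// /F /E -cut_errE ?gt_eqF// sumrB mulr_suml.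
  rewrite -[X in _ = _ - X + _]mulr_sumr /box_cut big_split/= -mulr_sumr sumr_const card_ord.
  have -> : \sum_(i < n) (2 * (x ord0 i - z ord0 i)) ^+ 2 = 4 * sqn (x - z).
    rewrite /sqn mulr_sumr; apply: eq_bigr => i _; rewrite !mxE; ring.
  rewrite -[X in _ = _ - _ * (_ + X) + _]mulr_natr; ring.
have [iE leE] : (rVmeas n).-integrable setT (EFin \o E) /\
    `|\int[rVmeas n]_x E x| <= k * M * (24 + 6 * n%:R) + k * M * (48 * Num.sqrt 2 ^+ n).
  apply: (@le_heat2 _ _ z _ _ _ t (2 * t)); rewrite ?mulr_gt0//.
    apply: (sqn_cont_mul (ltW s0)) => q.
    have -> : cut_err n t k = fun q => 4 * q * cut2 n t k q + 2 * n%:R * cut1 n t k q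
      - cut n t k q * (- n%:R / (2 * t) + q / (4 * t ^+ 2)).
      by apply/funext => r; rewrite cut_errE ?gt_eqF.
    apply: cvgB; first apply: cvgD.
    - apply: cvgM; last exact: continuous_cut2.
      by apply: cvgM; [exact: cvg_cst|exact: cvg_id].
    - by apply: cvgM; [exact: cvg_cst|exact: der_continuous (is_derive_cut1 n t k q)].
    - apply: cvgM; first exact: der_continuous (is_derive_cut n t k q).
      by apply: cvgD; [exact: cvg_cst|apply: cvgM; [exact: cvg_id|exact: cvg_cst]].
  move=> x; have q0 := sqn_ge0 (x - z).
  rewrite normrM (le_trans (ler_pM (normr_ge0 _) (normr_ge0 _) (uM x (ltW s0))
    (cut_err_le n t0 (ltW k0) q0)))//.
  have := sqn_heat_le z x t0; rewrite !(heatE z t x).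
  move: (heat_fun n t (sqn (x - z))) (heat (2 * t) z x) => h h'.
  move: (sqn (x - z)) q0 => q q0 hq.
  have : k * M * (6 / t) * (q * h) <= k * M * (6 / t) * (8 * t * Num.sqrt 2 ^+ n * h').
    by rewrite ler_wpM2l// !mulr_ge0// ?invr_ge0 ?ltW.
  rewrite (_ : _ * (8 * t * _ * h') = k * M * (48 * Num.sqrt 2 ^+ n) * h'); last first.
    by move: (Num.sqrt 2 ^+ n) => c; field; rewrite gt_eqF.
  move=> h3; rewrite [leLHS](_ : _ = k * M * (24 + 6 * n%:R) * h + k * M * (6 / t) * (q * h)).
    by rewrite lerD2l.
  ring.
have iS : (rVmeas n).-integrable setT (EFin \o (fun x => \sum_(i < n) F i x)).
  rewrite (_ : EFin \o _ = fun x => (\sum_(i < n) (F i x)%:E)%E); last first.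
    by apply/funext => x; rewrite /= -sumEFin.
  by apply: integrable_sum => // i _; have [] := FP i.
under eq_Rintegral do rewrite dE.
rewrite (RintegralD measurableT iS iE).
have -> : \int[rVmeas n]_x (\sum_(i < n) F i x) = 0.
  rewrite /Rintegral; under eq_integral do rewrite -sumEFin.
  rewrite (integral_sum measurableT (f := fun i x => (F i x)%:E)); last by move=> i; have [] := FP i.
  rewrite big1// => i _; have [iF] := FP i; rewrite /Rintegral => F0.
  by rewrite -(fineK (integrable_fin_num measurableT iF)) F0.
rewrite add0r (le_trans leE)// le_eqVlt; apply/orP; left; apply/eqP; ring.
Qed.

Let is_derive_psi k T s : 0 < k -> 0 < s < T ->
  is_derive s 1 (psi k T) (\int[rVmeas n]_x dpsi k T s x).
Proof.
move=> k0 /andP[s0 sT]; have k0' := ltW k0.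
(* Half the distance from s to the ends of (0, T), which leaves a neighbourhood of s inside (d, T -
   d). *)
pose d := Num.min s (T - s) / 2.
have m0 : 0 < Num.min s (T - s) by rewrite lt_min s0 subr_gt0.
have d0 : 0 < d by rewrite divr_gt0.
have [ds dTs] : d < s /\ d < T - s.
  have /andP[? ?] : (Num.min s (T - s) <= s) && (Num.min s (T - s) <= T - s).
    by rewrite !ge_min !lexx orbT.
  by rewrite /d; split; lra.
have Is : `]d, (T - d)[%classic s by rewrite /= in_itv/= ds; lra.
have IP r : `]d, (T - d)[%classic r -> [/\ 0 < r, r < T & d < r < T - d].
  by rewrite /= in_itv/= => /andP[? ?]; split; [lra|lra|apply/andP; split].
pose f r (x : 'rV[R]_n) := u x r * cut n (T - r) k (sqn (x - z)).
pose G x := heat_norm n d / heat_norm n T *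
    ((M1 + M * (n%:R / (2 * d))) * heat T z x
     + M / (4 * d ^+ 2) * (8 * T * Num.sqrt 2 ^+ n) * heat (2 * T) z x).
have T0 : 0 < T by exact: lt_trans sT.
have ch x : 0 <= heat_norm n d / heat_norm n T by rewrite divr_ge0 ?ltW ?heat_norm_gt0.
have G0 x : 0 <= G x by have [_ _ h] := IP _ Is; exact: le_trans (normr_ge0 _) (dpsi_le x d0 h k0').
have hf r : `]d, (T - d)[%classic r ->
    (rVmeas n).-integrable setT (EFin \o f r).
  by move=> /IP[r0 rT _]; apply: integrable_psi; rewrite ?(ltW r0)// subr_gt0.
have df r x : `]d, (T - d)[%classic r -> setT x -> derivable (f ^~ x) r 1.
  move=> /IP[r0 rT _] _; have rP : 0 < r < T by rewrite r0.
  by have [] := @is_derive_psi_integrand k T r x rP.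
have dfE r x : `]d, (T - d)[%classic r -> partial1of2 f r x = dpsi k T r x.
  move=> /IP[r0 rT _]; have rP : 0 < r < T by rewrite r0.
  by rewrite partial1of2E; have [_] := @is_derive_psi_integrand k T r x rP.
have iG : (rVmeas n).-integrable setT (EFin \o G).
  have T20 : 0 < 2 * T by rewrite mulr_gt0.
  exact: (integrableZl measurableT _ (integrableD measurableT
    (integrableZl measurableT _ (integrable_heat z T0))
    (integrableZl measurableT _ (integrable_heat z T20)))).
have GB r x : `]d, (T - d)[%classic r -> setT x -> `|partial1of2 f r x| <= G x.
  by move=> Ir _; rewrite dfE//; have [_ _ h] := IP _ Ir; exact: dpsi_le.
apply: DeriveDef.
  exact: (derivable_under_integral measurableT Is hf df G0 iG GB).
rewrite -derive1E (differentiation_under_integral measurableT Is hf df G0 iG GB).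
by apply: eq_Rintegral => x _; rewrite dfE.
Qed.

(** The mean value theorem on [s, t] for [psi k (s + t)], which is close to [theta s t] at s and to
    [theta t s] at t. All three errors are of order k, and k is arbitrary. *)
Let theta_swap s t : 0 < s -> s < t -> theta s t = theta t s.
Proof.
move=> s0 st; have t0 : 0 < t by exact: lt_trans st.
set K := M * (24 + 6 * n%:R + 48 * Num.sqrt 2 ^+ n).
have K0 : 0 <= K by rewrite mulr_ge0// !addr_ge0// mulr_ge0// exprn_ge0// sqrtr_ge0.
set L := 3 * M * (8 * t * Num.sqrt 2 ^+ n) + 3 * M * (8 * s * Num.sqrt 2 ^+ n) + K * (t - s).
have L0 : 0 <= L.
  by rewrite !addr_ge0// !mulr_ge0 ?exprn_ge0 ?sqrtr_ge0 ?subr_ge0// ltW.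
have bnd k : 0 < k -> `|theta s t - theta t s| <= k * L.
  move=> k0.
  have h1 := psi_near_theta (ltW s0) t0 (ltW k0).
  have h2 := psi_near_theta (ltW t0) s0 (ltW k0).
  have [c /[!in_itv]/= /andP[sc ct] h3] : exists2 c, c \in `[s, t]%R &
      psi k (s + t) t - psi k (s + t) s = (\int[rVmeas n]_x dpsi k (s + t) c x) * (t - s).
    apply: (@MVT_segment _ (psi k (s + t)) (fun c => \int[rVmeas n]_x dpsi k (s + t) c x)).
    - exact: ltW.
    - by move=> c /[!in_itv]/= /andP[? ?]; apply: is_derive_psi => //; apply/andP; split; lra.
    - apply: derivable_within_continuous => c /[!in_itv]/= /andP[? ?].
      by have [] := @is_derive_psi k (s + t) c k0; [apply/andP; split; lra|].
  have h4 : `|psi k (s + t) t - psi k (s + t) s| <= k * K * (t - s).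
    rewrite h3 normrM (@ger0_norm _ (t - s)) ?subr_ge0 ?(ltW st)//.
    rewrite ler_wpM2r ?subr_ge0 ?(ltW st)// integral_dpsi//; apply/andP; split; lra.
  rewrite (addrC t s) in h2.
  have -> : theta s t - theta t s = (psi k (s + t) t - theta t s) -
     (psi k (s + t) s - theta s t) - (psi k (s + t) t - psi k (s + t) s) by ring.
  rewrite (le_trans (ler_normB _ _))// (le_trans (lerD (ler_normB _ _) (lexx _)))//.
  rewrite (le_trans (lerD (lerD h2 h1) h4))// /L; lra.
apply/eqP; rewrite -subr_eq0 -normr_eq0 eq_le normr_ge0 andbT.
(* Dividing by L + 1 and not by L covers L = 0. *)
apply/ler_addgt0Pr => e e0; rewrite add0r; rewrite (le_trans (bnd (e / (L + 1)) _))//.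
  by rewrite divr_gt0// ltr_wpDl.
by rewrite mulrAC ler_pdivrMr ?ltr_wpDl// ler_pM2l// lerDl.
Qed.

(** Bounded time derivative: the convergence to the initial value is uniform in x, so it can be
    integrated against the kernel. *)
Let u_near0 x s : 0 < s -> `|u x s - u x 0| <= M1 * s.
Proof.
move=> s0.
have cux : {within `[0, s], continuous (u x)}.
  apply/continuous_within_itvP => //; split.
  - by move=> r /[!in_itv]/= /andP[r0 _]; exact: der_continuous (dut x r0).
  - exact: cut0.
  - by apply: cvg_at_left_filter; exact: der_continuous (dut x s0).
have [r /[!in_itv]/= /andP[r0 _] ->] := MVT s0 (fun r h => dut x (proj1 (andP h))) cux.
by rewrite subr0 normrM (gtr0_norm s0) ler_wpM2r ?(ltW s0)// utM.
Qed.

Let theta_near0 s t : 0 < s -> 0 < t -> `|theta s t - theta 0 t| <= M1 * s.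
Proof.
move=> s0 t0; rewrite /theta -RintegralB//; [|apply: integrable_theta; rewrite ?(ltW s0)//..].
have [||_] := @le_heat2 _ _ z (fun x => u x s * heat t z x - u x 0 * heat t z x)
  (M1 * s) 0 t t t0 t0.
- by apply: measurable_funB; apply: (sqn_cont_mul _ (@continuous_heat_fun t)); rewrite ?(ltW s0).
- move=> x; rewrite mul0r addr0 -mulrBl normrM (ger0_norm (heat_ge0 _ _ _)).
  by rewrite ler_wpM2r ?heat_ge0// u_near0.
by rewrite addr0.
Qed.

(** Approximate identity with a Chebyshev estimate: near z continuity gives e, and at distance at
    least d the oscillation 2M is at most 2M q / d^2, whose integral against the kernel is of order
    s. *)
Let theta_cvg t (e : R) : 0 < t -> 0 < e -> exists2 C, 0 <= C &
  forall s, 0 < s -> `|theta t s - u z t| <= e + C * s.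
Proof.
move=> t0 e0.
have /cvgrPdist_le/(_ _ e0)/nbhs_ballP[d /= d0 zd] := @cu t (ltW t0) z.
exists (2 * M / d ^+ 2 * (8 * Num.sqrt 2 ^+ n)).
  by rewrite mulr_ge0 ?divr_ge0 ?mulr_ge0 ?exprn_ge0 ?sqrtr_ge0// ltW.
move=> s s0.
have -> : u z t = \int[rVmeas n]_x (u z t * heat s z x).
  by rewrite (RintegralZl _ measurableT (integrable_heat z s0)) Rintegral_heat// mulr1.
have ih : (rVmeas n).-integrable setT (EFin \o (fun x => u z t * heat s z x)).
  exact: (integrableZl measurableT (u z t) (integrable_heat z s0)).
rewrite /theta -RintegralB//; last by apply: integrable_theta; rewrite ?(ltW t0).
have [||_] := @le_heat2 _ _ z (fun x => u x t * heat s z x - u z t * heat s z x)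
  e (2 * M / d ^+ 2 * (8 * s * Num.sqrt 2 ^+ n)) s (2 * s) s0 (mulr_gt0 (ltr0Sn R 1) s0).
- apply: measurable_funB.
    by apply: (sqn_cont_mul _ (@continuous_heat_fun s)); rewrite ?(ltW t0).
  by apply: measurable_funM => //; exact: measurable_heat.
- move=> x; rewrite -mulrBl normrM (ger0_norm (heat_ge0 _ _ _)).
  apply: (@le_trans _ _ ((e + 2 * M / d ^+ 2 * sqn (x - z)) * heat s z x)); last first.
    rewrite mulrDl lerD2l -mulrA -[leRHS]mulrA ler_wpM2l ?sqn_heat_le//.
    by rewrite divr_ge0 ?mulr_ge0 ?(ltW d0).
  rewrite ler_wpM2r ?heat_ge0//.
  have Mq0 : 0 <= 2 * M / d ^+ 2 * sqn (x - z).
    by rewrite mulr_ge0 ?sqn_ge0// divr_ge0 ?mulr_ge0 ?(ltW d0).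
  have [zx|zx] := pselect (ball z d x).
    by rewrite distrC (le_trans (zd _ zx))// lerDl.
  have dq : d ^+ 2 <= sqn (x - z).
    rewrite leNgt; apply/negP => qd; apply: zx; split => // i j.
    rewrite (ord1 i) -ball_normE/= ltNge; apply/negP => dz.
    have : (x ord0 j - z ord0 j) ^+ 2 <= sqn (x - z).
      by rewrite /sqn (bigD1 j)//= !mxE lerDl sumr_ge0// => l _; rewrite sqr_ge0.
    rewrite -real_normK ?num_real// distrC leNgt (lt_le_trans qd)//.
    by rewrite lerXn2r ?nnegrE// ltW.
  rewrite (@le_trans _ _ (2 * M))//.
    by rewrite (le_trans (ler_normB _ _))// mulr2n mulrDl mul1r lerD// uM// ltW.
  rewrite (@le_trans _ _ (2 * M / d ^+ 2 * sqn (x - z)))//; last by rewrite lerDr ltW.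
  by rewrite mulrAC ler_pdivlMr ?exprn_gt0// ler_wpM2l// mulr_ge0.
by move=> /le_trans; apply; rewrite lerD2l; rewrite le_eqVlt; apply/orP; left; apply/eqP; ring.
Qed.

Lemma heat_representation t : 0 < t ->
  (rVmeas n).-integrable setT (EFin \o (fun x => u x 0 * heat t z x)) /\
  u z t = \int[rVmeas n]_x (u x 0 * heat t z x).
Proof.
move=> t0; split; first exact: integrable_theta.
apply/eqP; rewrite -subr_eq0 -normr_eq0 eq_le normr_ge0 andbT.
apply/ler_addgt0Pr => e e0; rewrite add0r.
have [C C0 hC] := theta_cvg t0 (divr_gt0 e0 (ltr0Sn R 1)).
have K0 : 0 < C + M1 + 1 by rewrite ltr_wpDl// addr_ge0.
pose s := Num.min (t / 2) (e / 2 / (C + M1 + 1)).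
have s0 : 0 < s by rewrite lt_min !divr_gt0.
have st : s < t by rewrite gt_min ltr_pdivrMr// mulr_natr mulr2n ltrDl t0.
have h1 := hC s s0; have h2 := theta_near0 s0 t0.
rewrite (theta_swap s0 st) in h2.
rewrite -/(theta 0 t) (_ : u z t - _ = (theta t s - theta 0 t) - (theta t s - u z t)); last by ring.
rewrite (le_trans (ler_normB _ _))// (le_trans (lerD h2 h1))//.
have : (C + M1 + 1) * s <= e / 2.
  by rewrite mulrC -ler_pdivlMr// ge_min lexx orbT.
by move=> h; nra.
Qed.

End representation.

(** * Monotone transport onto a Gaussian *)

Section distribution_function.
Context {R : realType}.
Notation mu := (@lebesgue_measure R).

(** Monotone convergence; the fundamental theorem of calculus is applied on segments only. *)
Lemma ge0_integral_le_segments (f : R -> R) (B : \bar R) :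
  continuous f -> (forall a, 0 <= f a) ->
  (forall N : nat, (\int[mu]_(a in `[(- N%:R)%R, N%:R]) (f a)%:E <= B)%E) ->
  (\int[mu]_a (f a)%:E <= B)%E.
Proof.
move=> cf f0 fB.
have mf : measurable_fun setT f by exact: continuous_measurable_fun.
pose g (N : nat) (a : R) : \bar R := ((f a)%:E * (\1_`[(- N%:R)%R, N%:R]%classic a)%:E)%E.
have gN N : (\int[mu]_a g N a = \int[mu]_(a in `[(- N%:R)%R, N%:R]) (f a)%:E)%E.
  rewrite [RHS]integral_mkcond; apply: eq_integral => a _.
  by rewrite /g patchE indicE; case: ifP => _; rewrite ?mule1 ?mule0.
have glim a : limn (g ^~ a) = (f a)%:E.
  apply: cvg_lim => //; apply: (@cvg_near_cst _ _ _ _ _) => //.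
  near=> N; rewrite /g indicE mem_set ?mule1//= in_itv/=.
  rewrite -ler_norml; near: N; exact: nbhs_infty_ger.
under eq_integral do rewrite -glim.
rewrite monotone_convergence//; last 3 first.
- move=> N; apply: emeasurable_funM; first exact/measurable_EFinP.
  by apply/measurable_EFinP; exact: measurable_indic.
- by move=> N a _; rewrite mule_ge0// lee_fin.
- move=> a _ m n mn; rewrite lee_wpmul2l ?lee_fin//.
  rewrite !indicE ler_nat.
  case: (boolP (a \in `[(- m%:R)%R, m%:R]%classic)) => // /set_mem.
  rewrite /= in_itv/= => /andP[h1 h2]; rewrite mem_set//= in_itv/=.
  have mnR : m%:R <= n%:R :> R by rewrite ler_nat.
  by apply/andP; split; lra.
apply: lime_le.
  apply: ereal_nondecreasing_is_cvgn => m n mn; rewrite !gN.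
  apply: ge0_subset_integral => //.
  - exact/measurable_EFinP/measurable_funTS.
  - by move=> a _; rewrite lee_fin.
  - have mnR : m%:R <= n%:R :> R by rewrite ler_nat.
    by move=> a /=; rewrite !in_itv/= => /andP[? ?]; apply/andP; split; lra.
by apply: nearW => N; rewrite gN.
Unshelve. all: by end_near. Qed.

(** If h stayed above e on a window of length (I + 1)/e, its integral would be at least I + 1. The
    length does not depend on the window, so small values occur arbitrarily far out on both
    sides. *)
Lemma integrable_small (h : R -> R) (e : R) : measurable_fun setT h ->
  (forall a, 0 <= h a) -> (\int[mu]_a (h a)%:E < +oo)%E -> 0 < e ->
  exists2 L, 0 < L & forall N, exists2 b, N <= b <= N + L & h b <= e.
Proof.
move=> mh h0 hoo e0.
pose I := fine (\int[mu]_a (h a)%:E)%E.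
have I0 : 0 <= I by rewrite fine_ge0// integral_ge0// => a _; rewrite lee_fin.
pose L := (I + 1) / e.
have L0 : 0 < L by rewrite divr_gt0// ltr_wpDl.
exists L => // N; apply: contrapT => nb.
have eh b : N <= b <= N + L -> e <= h b.
  by move=> Nb; rewrite leNgt; apply/negP => /ltW hb; apply: nb; exists b.
have : (\int[mu]_(a in `[N, (N + L)%R]) (cst e%:E) a <= \int[mu]_a (h a)%:E)%E.
  apply: (@le_trans _ _ (\int[mu]_(a in `[N, (N + L)%R]) (h a)%:E)%E).
    apply: ge0_le_integral => //=.
    - by move=> a _; rewrite lee_fin ltW.
    - exact/measurable_EFinP/measurable_funTS.
  apply: ge0_subset_integral => //; first exact/measurable_EFinP.
  by move=> a _; rewrite lee_fin.
rewrite integral_cst//= lebesgue_measure_itv/= lte_fin ltrDl L0 -EFinB (addrC N) addrK.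
rewrite -[leRHS]fineK ?ge0_fin_numE ?integral_ge0//; last by move=> a _; rewrite lee_fin.
rewrite -EFinM lee_fin /L mulrC divfK ?gt_eqF// -/I.
by rewrite leNgt ltrDl ltr01.
Qed.

Section cdf.
Variables (p : R -> R) (M : R).
Hypotheses (cp : continuous p) (p0 : forall a, 0 < p a)
  (pM : (\int[mu]_a (p a)%:E = M%:E)%E).

Definition cdf_of (a : R) : R := \int[mu]_(b in `]-oo, a]) p b.

Let mp : measurable_fun setT p.
Proof. exact: continuous_measurable_fun. Qed.

Let ip : mu.-integrable setT (EFin \o p).
Proof.
apply/integrableP; split; first exact/measurable_EFinP.
under eq_integral do rewrite /= ger0_norm ?(ltW (p0 _))//.
by rewrite pM ltry.
Qed.

Let ipS (A : set R) : measurable A -> mu.-integrable A (EFin \o p).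
Proof. by move=> mA; apply: integrableS ip. Qed.

Lemma is_derive_cdf_of (a : R) : is_derive a 1 cdf_of (p a).
Proof.
have [d e] : derivable cdf_of a 1 /\ derive1 cdf_of a = p a.
  by apply: (@continuous_FTC1 _ p -oo%O a (a + 1)) ; [by rewrite ltrDl|exact: ipS|by rewrite ltNyr|exact: cp].
by apply: DeriveDef => //; rewrite -derive1E.
Qed.

Lemma cdf_of_lt a b : a < b -> cdf_of a < cdf_of b.
Proof.
move=> ab; have [c _ h] := MVT ab (fun x _ => is_derive_cdf_of x)
  (continuous_subspaceT (fun x => der_continuous (is_derive_cdf_of x))).
by rewrite -subr_gt0 h mulr_gt0// subr_gt0.
Qed.

Lemma cdf_of_ge0 a : 0 <= cdf_of a.
Proof. by apply: Rintegral_ge0 => b _; exact: ltW. Qed.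

Lemma cdf_of_le a : cdf_of a <= M.
Proof.
rewrite -lee_fin -pM /cdf_of /Rintegral fineK; last first.
  by apply: (integrable_fin_num _ (ipS _)).
apply: ge0_subset_integral => //; first exact/measurable_EFinP.
by move=> b _; rewrite lee_fin ltW.
Qed.

Lemma cdf_of_gt0 a : 0 < cdf_of a.
Proof. by rewrite (le_lt_trans (cdf_of_ge0 (a - 1)))// cdf_of_lt// gtrDl ltrN10. Qed.

Lemma cdf_of_ltM a : cdf_of a < M.
Proof. by rewrite (lt_le_trans _ (cdf_of_le (a + 1)))// cdf_of_lt// ltrDl. Qed.

Let cdf_indic (a : R) :
  (\int[mu]_b ((p b)%:E * (\1_`]-oo, a]%classic b)%:E) = (cdf_of a)%:E)%E.
Proof.
rewrite /cdf_of /Rintegral fineK; last by apply: (integrable_fin_num _ (ipS _)).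
rewrite [RHS]integral_mkcond; apply: eq_integral => b _.
by rewrite patchE indicE; case: ifP => _; rewrite ?mule1 ?mule0.
Qed.

(** Dominated convergence with majorant p; the limits at the two ends are the cases l = 0 and l =
    1. *)
Let cdf_cvg (s : nat -> R) (l : R -> R) :
  (forall b, \forall N \near \oo, \1_`]-oo, s N]%classic b = l b) ->
  (cdf_of (s N))%:E @[N --> \oo] --> (\int[mu]_b ((p b)%:E * (l b)%:E))%E.
Proof.
move=> sl; under eq_fun do rewrite -cdf_indic.
apply: (@dominated_cvg _ _ _ mu _ _ _ _ (EFin \o p)) => //.
- move=> N; apply: emeasurable_funM; first exact/measurable_EFinP.
  by apply/measurable_EFinP; exact: measurable_indic.
- move=> b _; apply: cvg_near_cst.
  by near=> N; rewrite (near (sl b) N).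
- move=> N b _; rewrite /= lee_fin normrM ger0_norm ?(ltW (p0 b))//.
  by rewrite ler_piMr ?(ltW (p0 b))// indicE; case: (_ \in _); rewrite ?normr1 ?normr0.
Unshelve. all: by end_near. Qed.

Lemma cdf_of_small (e : R) : 0 < e -> exists a, cdf_of a < e.
Proof.
move=> e0.
have h : (cdf_of (- N%:R))%:E @[N --> \oo] --> (\int[mu]_b ((p b)%:E * (0 : R)%:E))%E.
  apply: (@cdf_cvg (fun N => - N%:R) (fun=> 0)) => // b; near=> N.
  rewrite indicE memNset//= in_itv/=; apply/negP; rewrite -ltNge ltrNl.
  by near: N; exact: nbhs_infty_gtr.
rewrite integral0_eq in h; last by move=> b _; rewrite mule0.
have /fine_cvgP[_ /cvgrPdist_lt/(_ _ e0)[N _ /(_ N (leqnn N))/=]] := h.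
by rewrite sub0r normrN ger0_norm ?cdf_of_ge0// => ?; exists (- N%:R).
Unshelve. all: by end_near. Qed.

Lemma cdf_of_large (e : R) : e < M -> exists a, e < cdf_of a.
Proof.
rewrite -subr_gt0 => e0.
have h : (cdf_of N%:R)%:E @[N --> \oo] --> (\int[mu]_b ((p b)%:E * (1 : R)%:E))%E.
  apply: (@cdf_cvg (fun N => N%:R) (fun=> 1)) => // b; near=> N.
  rewrite indicE mem_set//= in_itv/=.
  by near: N; exact: nbhs_infty_ger.
have hM : (\int[mu]_b ((p b)%:E * (1 : R)%:E) = M%:E)%E.
  by rewrite -pM; apply: eq_integral => b _; rewrite mule1.
rewrite hM in h.
have /fine_cvgP[_ /cvgrPdist_lt/(_ _ e0)[N _ /(_ N (leqnn N))/=]] := h.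
rewrite ger0_norm ?subr_ge0 ?cdf_of_le// => ?; exists N%:R; lra.
Unshelve. all: by end_near. Qed.

End cdf.
End distribution_function.

Section transport.
Context {R : realType}.
Notation mu := (@lebesgue_measure R).

Definition gdens (t z : R) : R := (Num.sqrt (4 * pi * t))^-1 * expR (- z ^+ 2 / (4 * t)).

Lemma gdens_gt0 t z : 0 < t -> 0 < gdens t z.
Proof. by move=> t0; rewrite mulr_gt0 ?expR_gt0// invr_gt0 sqrtr_gt0 !mulr_gt0 ?pi_gt0. Qed.

Lemma gdensE t z : 0 < t -> gdens t z = normal_pdf 0 (Num.sqrt (2 * t)) z.
Proof.
move=> t0; have s20 : Num.sqrt (2 * t) != 0 by rewrite gt_eqF// sqrtr_gt0 mulr_gt0.
rewrite normal_pdfE// /normal_peak /normal_fun sqr_sqrtr ?mulr_ge0 1?ltW// subr0.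
rewrite /gdens; congr (_^-1 * expR (_ / _)); last by ring.
by congr Num.sqrt; ring.
Qed.

Lemma continuous_gdens t : 0 < t -> continuous (gdens t).
Proof.
move=> t0; have -> : gdens t = normal_pdf 0 (Num.sqrt (2 * t)) by apply/funext => z; exact: gdensE.
by apply: continuous_normal_pdf; rewrite gt_eqF// sqrtr_gt0 mulr_gt0.
Qed.

Lemma integral_gdens t : 0 < t -> (\int[mu]_z (gdens t z)%:E = 1%:E)%E.
Proof.
move=> t0; under eq_integral do rewrite gdensE//.
exact: integral_normal_pdf.
Qed.

(* Bounds [\int T^2 p / M]: [z^2 g(z)] is at most a multiple of [1/(1+z^2)], and
   [T'/(1+T^2)], the derivative of [atan T], has integral at most [pi]. *)
Definition transport_const (t : R) : R := (4 * t + 64 * t ^+ 2) * (Num.sqrt (4 * pi * t))^-1 * pi.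

(** With s = z^2 / (4t) the claim is 4t s e^(-s) + 16 t^2 s^2 e^(-s) <= 4t + 64 t^2, from s e^(-s)
    <= 1 and s^2 e^(-s) <= 4. *)
Let sqr_gdens_le t z : 0 < t ->
  z ^+ 2 * gdens t z <= (4 * t + 64 * t ^+ 2) * (Num.sqrt (4 * pi * t))^-1 * (1 + z ^+ 2)^-1.
Proof.
move=> t0; rewrite ler_pdivlMr; last by rewrite ltr_pwDl// sqr_ge0.
rewrite /gdens (_ : z ^+ 2 * _ * _ = z ^+ 2 * (1 + z ^+ 2) * expR (- z ^+ 2 / (4 * t)) * (Num.sqrt (4 * pi * t))^-1); last by ring.
rewrite ler_wpM2r ?invr_ge0 ?sqrtr_ge0//.
pose s := z ^+ 2 / (4 * t).
have s0 : 0 <= s by rewrite divr_ge0 ?sqr_ge0// mulr_ge0// ltW.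
have -> : z ^+ 2 = 4 * t * s by rewrite /s mulrC divfK// gt_eqF// mulr_gt0.
have -> : - (4 * t * s) / (4 * t) = - s by field; rewrite gt_eqF.
have e0 : 0 < expR (- s) by exact: expR_gt0.
have h1 : s * expR (- s) <= 1.
  by rewrite expRN ler_pdivrMr ?expR_gt0// mul1r (le_trans _ (expR_ge1Dx _))// lerDr.
have h2 : s ^+ 2 * expR (- s) <= 4.
  have h3 : s * expR (- (s / 2)) <= 2.
    rewrite expRN ler_pdivrMr ?expR_gt0//.
    by have := expR_ge1Dx (s / 2); lra.
  have -> : expR (- s) = expR (- (s / 2)) ^+ 2 by rewrite -expRM_natl; congr expR; field.
  rewrite -exprMn (_ : 4 = 2 ^+ 2); last by ring.
  by rewrite lerXn2r ?nnegrE ?(mulr_ge0 s0) ?expR_ge0.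
have t20 : 0 <= 16 * t ^+ 2 by rewrite mulr_ge0 ?sqr_ge0.
have := lerD (ler_wpM2l (mulr_ge0 (ler0n R 4) (ltW t0)) h1) (ler_wpM2l t20 h2).
by rewrite (_ : 16 * t ^+ 2 * 4 = 64 * t ^+ 2) ?mulr1; [apply: le_trans; rewrite le_eqVlt; apply/orP; left; apply/eqP; ring|ring].
Qed.

Lemma transport_exists (p : R -> R) (M t : R) : 0 < t ->
  continuous p -> (forall a, 0 < p a) -> (\int[mu]_a (p a)%:E = M%:E)%E ->
  exists T dT : R -> R, [/\ forall a : R, is_derive a 1 T (dT a), continuous dT,
     forall a, 0 < dT a, forall a, p a = M * gdens t (T a) * dT a &
    [/\ forall c, exists N, forall a, N <= a -> c <= T a,
        forall c, exists N, forall a, a <= N -> T a <= c &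
        (\int[mu]_a (T a ^+ 2 * p a)%:E <= (M * transport_const t)%:E)%E]].
Proof.
move=> t0 cp p0 pM.
have M0 : 0 < M by apply: le_lt_trans (cdf_of_ltM cp p0 pM 0); exact: cdf_of_ge0.
have cg := continuous_gdens t0; have g0 z := gdens_gt0 z t0.
have gM := integral_gdens t0.
pose Phi := cdf_of (gdens t); pose P (a : R) : R := cdf_of p a / M.
have dPhi (y : R) : is_derive y 1 Phi (gdens t y) := is_derive_cdf_of cg g0 gM y.
have ltPhi x y : x < y -> Phi x < Phi y by exact: cdf_of_lt cg g0 gM _ _.
have lePhi x y : x <= y -> Phi x <= Phi y.
  by rewrite le_eqVlt => /predU1P[->//|/ltPhi/ltW].
have cPhi : continuous Phi by move=> y; exact: der_continuous (dPhi y).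
have injPhi x y : Phi x = Phi y -> x = y.
  by move=> e; case: (ltgtP x y) => // /ltPhi; rewrite e ltxx.
(* The inverse of [Phi]. The default 0 is never met, since [P a] lies strictly between 0 and 1, the
   range of [Phi]. *)
pose Psi v := xget 0 [set y | Phi y = v].
have PhiK y : Psi (Phi y) = y.
  by rewrite /Psi; case: xgetP => [x _ /= /injPhi//|/(_ y) []].
have PsiK a : Phi (Psi (P a)) = P a.
  have Pa0 : 0 < P a by rewrite divr_gt0// (cdf_of_gt0 cp p0 pM).
  have Pa1 : P a < 1 by rewrite ltr_pdivrMr// mul1r (cdf_of_ltM cp p0 pM).
  have [y1 y1P] := cdf_of_small cg g0 gM Pa0.
  have [y2 y2P] := cdf_of_large cg g0 gM Pa1.
  have y12 : y1 <= y2.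
    rewrite leNgt; apply/negP => /ltPhi; rewrite ltNge ltW//.
    exact: lt_trans y1P y2P.
  have [||c _ cP] := @IVT _ Phi _ _ (P a) y12.
  - exact: continuous_subspaceT.
  - by rewrite ge_min le_max (ltW y1P) (ltW y2P) orbT.
  by rewrite -cP PhiK.
pose T a := Psi (P a).
have PhiT a : Phi (T a) = P a := PsiK a.
(* Differentiating [Phi (T a) = P a] gives g(T) T' = p / M. *)
pose dT a := (gdens t (T a))^-1 * (p a / M).
have dTP (a : R) : is_derive a 1 T (dT a).
  have dP : is_derive a 1 P (p a / M).
    apply: is_derive_eq (derM (is_derive_cdf_of cp p0 pM a) (der_cst a M^-1)) _.
    by rewrite mulr0 add0r.
  have dPsi : is_derive (P a) 1 Psi (gdens t (T a))^-1.
    rewrite -PhiT; apply: (@is_derive_inverse R Phi) => //.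
    - by near=> y; exact: PhiK.
    - by near=> y; exact: cPhi.
    - by rewrite gt_eqF.
  exact: der_comp dPsi dP.
have cT : continuous T by move=> a; exact: der_continuous (dTP a).
have dT0 a : 0 < dT a by rewrite mulr_gt0 ?invr_gt0// divr_gt0.
have pE a : p a = M * gdens t (T a) * dT a.
  by rewrite /dT; field; rewrite !gt_eqF.
have cdT : continuous dT.
  move=> a; apply: cvgM; last by apply: cvgM; [exact: cp|exact: cvg_cst].
  apply: cvgV; first by rewrite gt_eqF.
  exact: (continuous_comp (cT a) (cg _)).
have monoT a b : a <= b -> T a <= T b.
  move=> ab; rewrite leNgt; apply/negP => /ltPhi; rewrite !PhiT ltNge ler_pM2r ?invr_gt0//.
  by move: ab; rewrite le_eqVlt => /predU1P[->|/(cdf_of_lt cp p0 pM)/ltW ->//]; rewrite lexx.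
exists T, dT; split => //; split.
- move=> c; have cM : M * Phi c < M by rewrite -[ltRHS]mulr1 ltr_pM2l// (cdf_of_ltM cg g0 gM).
  have [N hN] := cdf_of_large cp p0 pM cM; exists N => a Na.
  rewrite (le_trans _ (monoT _ _ Na))// leNgt; apply/negP => /ltPhi.
  by rewrite PhiT ltNge ler_pdivlMr// mulrC ltW.
- move=> c; have cM : 0 < M * Phi c by rewrite mulr_gt0// (cdf_of_gt0 cg g0 gM).
  have [N hN] := cdf_of_small cp p0 pM cM; exists N => a Na.
  rewrite (le_trans (monoT _ _ Na))// leNgt; apply/negP => /ltPhi.
  by rewrite PhiT ltNge ler_pdivrMr// mulrC ltW.
(* By the change of variables T^2 p = M T^2 g(T) T' is at most a multiple of T' / (1 + T^2), the
   derivative of atan T. *)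
- pose H a := atan (T a); pose h a := (1 + T a ^+ 2)^-1 * dT a.
  have T1 a : 0 < 1 + T a ^+ 2 by rewrite ltr_pwDl// sqr_ge0.
  have dH (a : R) : is_derive a 1 H (h a) := der_comp (is_derive1_atan (T a)) (dTP a).
  have cTX : continuous (fun a => T a ^+ 2).
    by move=> a; exact: (continuous_comp (cT a) (@exprn_continuous R 2 _)).
  have ch : continuous h.
    move=> a; apply: cvgM; last exact: cdT.
    by apply: cvgV; rewrite ?gt_eqF//; apply: cvgD; [exact: cvg_cst|exact: cTX].
  have cTp : continuous (fun a => T a ^+ 2 * p a) by move=> a; apply: cvgM; [exact: cTX|exact: cp].
  set K0 := (4 * t + 64 * t ^+ 2) * (Num.sqrt (4 * pi * t))^-1.
  have K00 : 0 <= K0.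
    by rewrite mulr_ge0 ?invr_ge0 ?sqrtr_ge0// addr_ge0 ?mulr_ge0 ?sqr_ge0// ltW.
  have TpK a : T a ^+ 2 * p a <= M * K0 * h a.
    rewrite pE /h (_ : T a ^+ 2 * _ = M * dT a * (T a ^+ 2 * gdens t (T a))); last by ring.
    rewrite (_ : M * K0 * _ = M * dT a * (K0 * (1 + T a ^+ 2)^-1)); last by ring.
    by rewrite ler_wpM2l ?sqr_gdens_le// mulr_ge0 ?ltW.
  apply: ge0_integral_le_segments => //.
    by move=> a; rewrite mulr_ge0 ?sqr_ge0 ?ltW.
  (* The segment for N = 0 is a point and is treated apart, as the fundamental theorem needs
     distinct ends. *)
  case=> [|N].
    by rewrite oppr0 set_itv1 integral_set1 lee_fin mulr_ge0 ?(ltW M0)// mulr_ge0// pi_ge0.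
  have N0 : - N.+1%:R < N.+1%:R :> R by rewrite -subr_gt0 opprK addr_gt0.
  have -> : (M * transport_const t)%:E = ((M * K0)%:E * pi%:E)%E by rewrite -EFinM mulrA.
  apply: (@le_trans _ _ (\int[mu]_(a in `[(- N.+1%:R)%R, N.+1%:R]) (M * K0 * h a)%:E)%E).
    apply: ge0_le_integral => //=.
    + by move=> a _; rewrite lee_fin mulr_ge0 ?sqr_ge0 ?ltW.
    + by apply/measurable_EFinP/measurable_funTS; exact: continuous_measurable_fun.
    + apply/measurable_EFinP/measurable_funTS; apply: continuous_measurable_fun => a.
      by apply: cvgM; [exact: cvg_cst|exact: ch].
    + by move=> a _; rewrite lee_fin.
  under eq_integral do rewrite EFinM.
  rewrite ge0_integralZl//=; last 3 first.
  + by apply/measurable_EFinP/measurable_funTS; exact: continuous_measurable_fun.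
  + by move=> a _; rewrite lee_fin; apply/ltW/mulr_gt0; rewrite ?invr_gt0.
  + by rewrite lee_fin mulr_ge0// ltW.
  apply: lee_wpmul2l; first by rewrite lee_fin mulr_ge0// ltW.
  rewrite (@continuous_FTC2 _ h H)//.
  + rewrite -EFinB lee_fin /H.
    have := atan_ltpi2 (T N.+1%:R); have := atan_gtNpi2 (T (- N.+1%:R)); lra.
  + exact: continuous_subspaceT.
  + split; last 2 first.
    * by apply: cvg_at_right_filter; exact: der_continuous (dH _).
    * by apply: cvg_at_left_filter; exact: der_continuous (dH _).
    * by move=> x _; have [] := dH x.
  + by move=> x _; rewrite derive1E; have [_ ->] := dH x.
Unshelve. all: by end_near. Qed.

End transport.

(** * Entropy and Fisher information *)

Section weighted.
Context {R : realType} (k : nat).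
Notation mu := (@lebesgue_measure R).

Lemma integral_rV_weighted (f : 'rV[R]_k.+1 -> R) (p w : R -> R) :
  measurable_fun setT f -> (forall x, 0 <= f x) ->
  (forall a, (\int[rVmeas k]_x (f (rcons0 (a, x)))%:E = (p a)%:E)%E) ->
  measurable_fun setT w -> (forall a, 0 <= w a) ->
  (\int[rVmeas k.+1]_x (w (x ord0 ord0) * f x)%:E = \int[mu]_a (w a * p a)%:E)%E.
Proof.
move=> mf f0 pE mw w0.
rewrite ge0_integral_rV_S; last 2 first.
- apply/measurable_EFinP/measurable_funM => //.
  by apply: (measurableT_comp mw); exact: measurable_coord.
- by move=> x; rewrite lee_fin mulr_ge0.
apply: eq_integral => a _.
under eq_integral do rewrite rcons0_0 EFinM /=.
rewrite ge0_integralZl ?pE//; last 2 first.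
- by move=> x _; rewrite lee_fin.
- by rewrite lee_fin.
by apply: (@measurable_slice _ _ (EFin \o f) a); exact/measurable_EFinP.
Qed.
End weighted.

(** * Integration by parts against the transport map *)

Section energy.
Context {R : realType} (k : nat).
Notation mu := (@lebesgue_measure R).
Variables (f D : 'rV[R]_k.+1 -> R) (p T dT : R -> R) (t Q : R).
Hypotheses (f0 : forall x, 0 < f x) (cf : continuous f) (cD : continuous D).
Hypothesis dfD : forall x (b : R),
  is_derive b 1 (fun b => f (x + b *: delta_mx ord0 ord0)) (D (x + b *: delta_mx ord0 ord0)).
Hypotheses (cp : continuous p) (pE : forall a, (\int[rVmeas k]_x (f (rcons0 (a, x)))%:E = (p a)%:E)%E).
Hypotheses (t0 : 0 < t) (dTP : forall a : R, is_derive a 1 T (dT a)) (cdT : continuous dT)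
  (dT0 : forall a, 0 < dT a)
  (T_large : forall c, exists N, forall a, N <= a -> c <= T a)
  (T_small : forall c, exists N, forall a, a <= N -> T a <= c)
  (TQ : (\int[mu]_a (T a ^+ 2 * p a)%:E <= Q%:E)%E).

Let cT : continuous T.
Proof. by move=> a; exact: der_continuous (dTP a). Qed.

Let cTX : continuous (fun a => T a ^+ 2).
Proof. by move=> a; exact: (continuous_comp (@cT a) (@exprn_continuous R 2 _)). Qed.

Let p0 a : 0 <= p a.
Proof. by rewrite -lee_fin -pE integral_ge0// => x _; rewrite lee_fin ltW. Qed.

Let fisher x := D x ^+ 2 / f x.

Let continuous_fisher : continuous fisher.
Proof.
move=> x; apply: (@cvgM _ _ (nbhs x)).
  by apply: (@cvg_comp _ _ _ D (fun r => r ^+ 2)); [exact: cD|exact: exprn_continuous].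
by apply: (@cvgV _ _ (nbhs x)); [rewrite gt_eqF|exact: cf].
Qed.

Let fisher_ge0 x : 0 <= fisher x.
Proof. by rewrite divr_ge0 ?sqr_ge0 ?ltW. Qed.

Let Tf (x : 'rV[R]_k.+1) := T (x ord0 ord0) ^+ 2 * f x.

Let continuous_Tf : continuous Tf.
Proof.
move=> x; apply: (@cvgM _ _ (nbhs x)); last exact: cf.
apply: (@cvg_comp _ _ _ (fun y : 'rV[R]_k.+1 => y ord0 ord0) (fun r => T r ^+ 2)).
  exact: coord_continuous.
exact: cTX.
Qed.

Let Tf_ge0 x : 0 <= Tf x.
Proof. by rewrite mulr_ge0 ?sqr_ge0 ?ltW. Qed.

Let integral_weighted (w : R -> R) : measurable_fun setT w -> (forall a, 0 <= w a) ->
  (\int[rVmeas k]_x \int[mu]_a (w a * f (rcons0 (a, x)))%:E = \int[mu]_a (w a * p a)%:E)%E.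
Proof.
move=> mw w0; have mf : measurable_fun setT f by exact: continuous_rV_measurable.
rewrite -(integral_rV_weighted mf (fun x => ltW (f0 x)) pE mw w0) ge0_integral_rV_S_swap.
- by apply: eq_integral => x _; apply: eq_integral => a _; rewrite rcons0_0.
- apply/measurable_EFinP/measurable_funM => //.
  by apply: (measurableT_comp mw); exact: measurable_coord.
- by move=> x; rewrite lee_fin mulr_ge0// ltW.
Qed.

Let integral_slices (F : 'rV[R]_k.+1 -> R) : continuous F -> (forall x, 0 <= F x) ->
  (\int[rVmeas k]_x \int[mu]_a (F (rcons0 (a, x)))%:E = \int[rVmeas k.+1]_x (F x)%:E)%E.
Proof.
move=> cF F0; rewrite ge0_integral_rV_S_swap//.
by apply/measurable_EFinP; exact: continuous_rV_measurable.
Qed.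

(** Putting the indicator into the weight makes integrals over a segment integrals over the line, so
    that [integral_weighted] applies. *)
Let wd (al be : R) a := dT a * \1_`[al, be]%classic a.

Let continuous_slice (F : 'rV[R]_k.+1 -> R) x : continuous F ->
  continuous (fun a : R => F (rcons0 (a, x))).
Proof.
move=> cF a; apply: (@cvg_comp _ _ _ (fun b : R => rcons0 (b, x)) F); last exact: cF.
exact: continuous_rcons0l.
Qed.

(* AM-GM: [- D T <= t D^2 / f + T^2 f / (4 t)] *)
Let amgm x T' : - (D x * T') <= t * fisher x + (4 * t)^-1 * (T' ^+ 2 * f x).
Proof.
have fx := f0 x; rewrite -subr_ge0 opprK /fisher.
rewrite [leRHS](_ : _ = (2 * t * D x + T' * f x) ^+ 2 / (4 * t * f x)).
  by rewrite divr_ge0 ?sqr_ge0// !mulr_ge0// ltW.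
by field; rewrite !gt_eqF.
Qed.

(** Integration by parts on a single line, where f is differentiable; for the marginal one would
    have to differentiate under the integral. The signs of T at the ends make both boundary terms
    nonnegative, so the inequality can be integrated over x by Tonelli, infinite values included. *)
Let segment (al be : R) (x : 'rV[R]_k) : al < be -> T al <= 0 -> 0 <= T be ->
  (\int[mu]_a (wd al be a * f (rcons0 (a, x)))%:E <=
    (T be * f (rcons0 (be, x)) + (- T al) * f (rcons0 (al, x)))%:E
    + (t%:E * \int[mu]_a (fisher (rcons0 (a, x)))%:E
    + (4 * t)^-1%:E * \int[mu]_a (Tf (rcons0 (a, x)))%:E))%E.
Proof.
move=> ab Ta Tb.
pose H (a : R) := f (rcons0 (a, x)) * T a.
pose h (a : R) := f (rcons0 (a, x)) * dT a + D (rcons0 (a, x)) * T a.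
pose e (a : R) := t * fisher (rcons0 (a, x)) + (4 * t)^-1 * Tf (rcons0 (a, x)).
have cfx := @continuous_slice _ x cf; have cDx := @continuous_slice _ x cD.
have cFx := @continuous_slice _ x (@continuous_fisher); have cTx := @continuous_slice _ x (@continuous_Tf).
have dH (a : R) : is_derive a 1 H (h a).
  have dfx : is_derive a 1 (fun a => f (rcons0 (a, x))) (D (rcons0 (a, x))).
    have := dfD (rcons0 (0, x)) a.
    rewrite rcons0_line0 add0r; congr (is_derive a 1 _ _).
    by apply/funext => b; rewrite rcons0_line0 add0r.
  exact: derM.
have ch : continuous h.
  move=> a; apply: cvgD; apply: cvgM; [exact: cfx|exact: cdT|exact: cDx|exact: cT].
have ce : continuous e.
  by move=> a; apply: cvgD; apply: cvgM; [exact: cvg_cst|exact: cFx|exact: cvg_cst|exact: cTx].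
have e0 a : 0 <= e a by rewrite addr_ge0// mulr_ge0 ?invr_ge0// ?mulr_ge0// ltW.
have int_seg (g : R -> R) : continuous g -> mu.-integrable `[al, be] (EFin \o g).
  move=> cg; apply: continuous_compact_integrable; first exact: segment_compact.
  exact: continuous_subspaceT.
have me : measurable_fun setT e by exact: continuous_measurable_fun.
have eE : (\int[mu]_a (e a)%:E = t%:E * \int[mu]_a (fisher (rcons0 (a, x)))%:E
    + (4 * t)^-1%:E * \int[mu]_a (Tf (rcons0 (a, x)))%:E)%E.
  under eq_integral do rewrite /e EFinD !EFinM.
  have mc (g : R -> R) : continuous g -> measurable_fun setT (fun a : R => (g a)%:E).
    by move=> cg; apply/measurable_EFinP; exact: continuous_measurable_fun.
  have Z (c : R) (g : R -> R) : 0 <= c -> continuous g -> (forall a, 0 <= g a) ->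
      (\int[mu]_a (c%:E * (g a)%:E) = c%:E * \int[mu]_a (g a)%:E)%E.
    move=> c0 cg g0; apply: ge0_integralZl; [by []|exact: mc| |by rewrite lee_fin].
    by move=> a _; rewrite lee_fin.
  have Z0 (c : R) (g : R -> R) : 0 <= c -> (forall a, 0 <= g a) ->
      (forall a : R, setT a -> (0 <= c%:E * (g a)%:E)%E).
    by move=> c0 g0 a _; rewrite -EFinM lee_fin mulr_ge0.
  have t4 : 0 <= (4 * t)^-1 by rewrite invr_ge0 mulr_ge0// ltW.
  rewrite ge0_integralD.
  - by rewrite (Z _ _ (ltW t0) cFx)// (Z _ _ t4 cTx).
  - by [].
  - exact: (Z0 _ _ (ltW t0) (fun a => fisher_ge0 _)).
  - by apply: measurable_funeM; exact: mc.
  - exact: (Z0 _ _ t4 (fun a => Tf_ge0 _)).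
  - by apply: measurable_funeM; exact: mc.
rewrite -eE.
have -> : (\int[mu]_a (wd al be a * f (rcons0 (a, x)))%:E =
    \int[mu]_(a in `[al, be]) (f (rcons0 (a, x)) * dT a)%:E)%E.
  rewrite [RHS]integral_mkcond; apply: eq_integral => a _.
  by rewrite /wd patchE indicE; case: ifP => _; rewrite ?(mulr1, mulr0, mul0r)// mulrC.
have -> : (T be * f (rcons0 (be, x)) + (- T al) * f (rcons0 (al, x)))%:E =
    (\int[mu]_(a in `[al, be]) (h a)%:E)%E.
  rewrite (@continuous_FTC2 _ h H)//.
  - by rewrite -EFinB /H; congr EFin; ring.
  - exact: continuous_subspaceT.
  - split; last 2 first.
    + by apply: cvg_at_right_filter; exact: der_continuous (dH _).
    + by apply: cvg_at_left_filter; exact: der_continuous (dH _).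
    + by move=> b _; have [] := dH b.
  - by move=> b _; rewrite derive1E; have [_ ->] := dH b.
apply: (@le_trans _ _ (\int[mu]_(a in `[al, be]) (h a)%:E + \int[mu]_(a in `[al, be]) (e a)%:E)%E).
  rewrite -integralD//; [|exact: int_seg|exact: int_seg].
  apply: le_integral => //.
  - by apply: int_seg => a; apply: cvgM; [exact: cfx|exact: cdT].
  - by apply: integrableD => //; exact: int_seg.
  move=> a _; rewrite -EFinD lee_fin /h -addrA lerDl -lerBlDl sub0r.
  by have := amgm (rcons0 (a, x)) (T a); rewrite /e /Tf rcons0_0.
rewrite leeD2l//; apply: ge0_subset_integral => //; first exact/measurable_EFinP.
by move=> a _; rewrite lee_fin.
Qed.

Let energy_segment (al be : R) : al < be -> T al <= 0 -> 0 <= T be ->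
  (\int[mu]_a (wd al be a * p a)%:E <=
    (T be * p be + (- T al) * p al)%:E
    + (t%:E * \int[rVmeas k.+1]_x (fisher x)%:E
    + (4 * t)^-1%:E * \int[mu]_a (T a ^+ 2 * p a)%:E))%E.
Proof.
move=> ab Ta Tb.
have w0 a : 0 <= wd al be a.
  by rewrite /wd indicE; case: (_ \in _); rewrite ?mulr1 ?mulr0// ltW.
have mw : measurable_fun setT (wd al be).
  by apply: (@measurable_funM _ _ _ _ dT \1_`[al, be]); [exact: continuous_measurable_fun|exact: measurable_indic].
rewrite -integral_weighted//.
have mf a : measurable_fun setT (fun x : 'rV[R]_k => (f (rcons0 (a, x)))%:E).
  by apply: (@measurable_slice _ _ (EFin \o f) a); apply/measurable_EFinP; exact: continuous_rV_measurable.
have mT : measurable_fun setT (fun a => T a ^+ 2).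
  by apply: measurable_funX; exact: continuous_measurable_fun.
have mG (G : 'rV[R]_k.+1 -> R) : continuous G -> (forall x, 0 <= G x) ->
    measurable_fun setT (fun x => \int[mu]_a (G (rcons0 (a, x)))%:E)%E.
  move=> cG G0.
  apply: (measurable_fun_fubini_tonelli_G (fun q => (G (rcons0 q))%:E)).
    apply: (measurableT_comp (f := EFin \o G)); last exact: measurable_rcons0.
    by apply/measurable_EFinP; exact: continuous_rV_measurable.
  by move=> q; rewrite lee_fin.
have Tbf x : (0 <= (T be * f (rcons0 (be, x)))%:E)%E by rewrite lee_fin mulr_ge0// ltW.
have Taf x : (0 <= ((- T al) * f (rcons0 (al, x)))%:E)%E.
  by rewrite lee_fin mulr_ge0 ?oppr_ge0// ltW.
pose rhs (x : 'rV[R]_k) := ((T be * f (rcons0 (be, x)))%:E + ((- T al) * f (rcons0 (al, x)))%:E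
    + (t%:E * \int[mu]_a (fisher (rcons0 (a, x)))%:E
    + (4 * t)^-1%:E * \int[mu]_a (Tf (rcons0 (a, x)))%:E))%E.
have I0 (G : 'rV[R]_k.+1 -> R) (x : 'rV[R]_k) : (forall x, 0 <= G x) ->
    (0 <= \int[mu]_a (G (rcons0 (a, x)))%:E)%E.
  by move=> G0; apply: integral_ge0 => a _; rewrite lee_fin.
have t1 : (0 <= t%:E)%E by rewrite lee_fin ltW.
have t2 : (0 <= (4 * t)^-1%:E)%E by rewrite lee_fin invr_ge0 mulr_ge0// ltW.
have m1 : measurable_fun setT (fun x : 'rV[R]_k => (T be * f (rcons0 (be, x)))%:E).
  by under eq_fun do rewrite EFinM; apply: measurable_funeM; exact: mf.
have m2 : measurable_fun setT (fun x : 'rV[R]_k => ((- T al) * f (rcons0 (al, x)))%:E).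
  by under eq_fun do rewrite EFinM; apply: measurable_funeM; exact: mf.
have m3 : measurable_fun setT (fun x : 'rV[R]_k => t%:E * \int[mu]_a (fisher (rcons0 (a, x)))%:E)%E.
  by apply: measurable_funeM; exact: mG.
have m4 : measurable_fun setT (fun x : 'rV[R]_k => (4 * t)^-1%:E * \int[mu]_a (Tf (rcons0 (a, x)))%:E)%E.
  by apply: measurable_funeM; exact: mG.
apply: (@le_trans _ _ (\int[rVmeas k]_x rhs x)%E).
  apply: ge0_le_integral => //.
  - by move=> x _; apply: integral_ge0 => a _; rewrite lee_fin mulr_ge0// ltW.
  - apply: (measurable_fun_fubini_tonelli_G (fun q : measurableTypeR R * 'rV[R]_k =>
      (wd al be q.1 * f (rcons0 q))%:E)).
      apply/measurable_EFinP/measurable_funM.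
        by apply: (measurableT_comp mw); exact: measurable_fst.
      apply: (measurableT_comp (f := f)); last exact: measurable_rcons0.
      exact: continuous_rV_measurable.
    by move=> q; rewrite lee_fin mulr_ge0// ltW.
  - by apply: emeasurable_funD; apply: emeasurable_funD.
  - by move=> x _; rewrite /rhs -EFinD; exact: segment.
rewrite /rhs ge0_integralD//; last 4 first.
- by move=> x _; exact: adde_ge0.
- exact: emeasurable_funD.
- by move=> x _; apply: adde_ge0; apply: mule_ge0 => //; exact: I0.
- exact: emeasurable_funD.
rewrite ge0_integralD// ge0_integralD//; last 2 first.
- by move=> x _; apply: mule_ge0 => //; exact: I0.
- by move=> x _; apply: mule_ge0 => //; exact: I0.
rewrite ge0_integralZl//; [|exact: mG|by move=> x _; exact: I0].
rewrite ge0_integralZl//; [|exact: mG|by move=> x _; exact: I0].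
rewrite !integral_slices//.
under eq_integral do rewrite EFinM.
rewrite ge0_integralZl//; last by move=> x _; rewrite lee_fin ltW.
under [X in (_ + X + _)%E]eq_integral do rewrite EFinM.
rewrite ge0_integralZl//; [|by move=> x _; rewrite lee_fin ltW|by rewrite lee_fin oppr_ge0].
rewrite !pE -!EFinM -EFinD leeD2l// leeD2l// lee_wpmul2l//.
rewrite -integral_slices// -integral_weighted//; last by move=> a; exact: sqr_ge0.
rewrite le_eqVlt; apply/orP; left; apply/eqP; apply: eq_integral => x _.
by apply: eq_integral => a _; rewrite /Tf rcons0_0.
Qed.

(* The boundary terms of the integration by parts are sent to 0 along points
   where the integrable function [T^2 p] is small. *)
Lemma energy_ineq :
  (\int[mu]_a (dT a * p a)%:E <= t%:E * \int[rVmeas k.+1]_x (D x ^+ 2 / f x)%:E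
    + (4 * t)^-1%:E * \int[mu]_a (T a ^+ 2 * p a)%:E)%E.
Proof.
have cTp : continuous (fun a => T a ^+ 2 * p a).
  by move=> a; apply: cvgM; [exact: cTX|exact: cp].
apply: ge0_integral_le_segments.
- by move=> a; apply: cvgM; [exact: cdT|exact: cp].
- by move=> a; rewrite mulr_ge0// ltW.
move=> N; apply/lee_addgt0Pr => e e0.
have e20 : 0 < e / 2 by rewrite divr_gt0.
have mTp := continuous_measurable_fun cTp.
have Tp0 a : 0 <= T a ^+ 2 * p a by rewrite mulr_ge0 ?sqr_ge0.
have [L L0 hL] := integrable_small mTp Tp0 (le_lt_trans TQ (ltry _)) e20.
(* Where |T| >= 1, the boundary term |T| p is at most T^2 p. *)
have [N1 hN1] := T_large 1; have [N2 hN2] := T_small (-1).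
pose B := Num.max (N%:R + 1) N1; pose A := Num.min (- N%:R - 1) N2.
have [be /andP[Bbe _] hbe] := hL B.
have [al /andP[_ Aal] hal] := hL (A - L); rewrite subrK in Aal.
have [NB N1B] : N%:R + 1 <= B /\ N1 <= B by rewrite !le_max !lexx orbT.
have [AN AN2] : A <= - N%:R - 1 /\ A <= N2 by rewrite !ge_min !lexx orbT.
have Tbe : 1 <= T be by apply: hN1; exact: le_trans Bbe.
have Tal : T al <= -1 by apply: hN2; exact: le_trans AN2.
have N0 : 0 <= N%:R :> R by rewrite ler0n.
have ab : al < be by lra.
apply: (@le_trans _ _ (\int[mu]_a (wd al be a * p a)%:E)%E).
  have -> : (\int[mu]_a (wd al be a * p a)%:E = \int[mu]_(a in `[al, be]) (dT a * p a)%:E)%E.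
    rewrite [RHS]integral_mkcond; apply: eq_integral => a _.
    by rewrite /wd patchE indicE; case: ifP => _; rewrite ?(mulr1, mulr0, mul0r).
  apply: ge0_subset_integral => //.
  - have mdp : measurable_fun setT (fun a => dT a * p a).
      by apply: continuous_measurable_fun => a; apply: cvgM; [exact: cdT|exact: cp].
    exact/measurable_EFinP/measurable_funTS.
  - by move=> a _; rewrite lee_fin mulr_ge0// ltW.
  - move=> a /=; rewrite !in_itv/= => /andP[h1 h2].
    by apply/andP; split; lra.
have := @energy_segment al be ab (le_trans Tal _) (le_trans ler01 Tbe).
move=> /(_ (lerN10 _))/le_trans; apply.
rewrite addeC leeD2l// lee_fin.
have h1 : T be * p be <= e / 2.
  by rewrite (le_trans _ hbe)// ler_wpM2r// expr2 ler_peMl// (le_trans ler01).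
have h2 : - T al * p al <= e / 2.
  rewrite (le_trans _ hal)// ler_wpM2r// -sqrrN expr2 ler_peMl//; lra.
by lra.
Qed.

End energy.

(** * Finiteness and continuity of iterated marginals *)

Section dominated_chain.
Context {R : realType}.
Notation mu := (@lebesgue_measure R).

(* A chain of integrable functions, each controlled on unit boxes by its
   successor; slicing preserves this, so that every iterated partial integral
   of [h 0] is finite and continuous. *)
Definition dominated_chain k (h : nat -> 'rV[R]_k -> R) : Prop :=
  [/\ forall j, measurable_fun setT (h j), forall j x, 0 <= h j x,
      forall j, (\int[rVmeas k]_x (h j x)%:E < +oo)%E &
      forall j, exists2 C, 0 <= C &
        forall x y : 'rV[R]_k, (forall i, `|x ord0 i - y ord0 i| <= 1) -> h j x <= C * h j.+1 y].

(** A slice of [h j] at a is at most C times the slice of [h j.+1] at any b in [a, a + 1]. Averaging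
    over b, an interval of length 1, bounds its integral by C times the full integral of [h j.+1].
    Each slicing uses up one successor, which is why the chain is infinite. *)
Lemma dominated_chain_slice k (h : nat -> 'rV[R]_k.+1 -> R) (a : R) :
  dominated_chain h -> dominated_chain (fun j x => h j (rcons0 (a, x))).
Proof.
move=> [mh h0 hoo hC].
have mhS j b : measurable_fun setT (fun x : 'rV[R]_k => h j (rcons0 (b, x))).
  apply/measurable_EFinP.
  by apply: (@measurable_slice _ _ (EFin \o h j) b); exact/measurable_EFinP.
have close b (x y : 'rV[R]_k) i : `|a - b| <= 1 -> (forall i, `|x ord0 i - y ord0 i| <= 1) ->
    `|rcons0 (a, x) ord0 i - (rcons0 (b, y) : 'rV[R]_k.+1) ord0 i| <= 1.
  by move=> ab xy; rewrite !rcons0E; case: unliftP.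
split => //; last first.
  move=> j; have [C C0 hjC] := hC j; exists C => // x y xy; apply: hjC => i.
  by apply: close => //; rewrite subrr normr0.
move=> j; have [C C0 hjC] := hC j.
pose L := (\int[rVmeas k]_x (h j (rcons0 (a, x)))%:E)%E.
have L0 : (0 <= L)%E by apply: integral_ge0 => x _; rewrite lee_fin.
have mI : measurable_fun [set: measurableTypeR R]
    (fun b => \int[rVmeas k]_x (h j.+1 (rcons0 (b, x)))%:E)%E.
  by apply: (@measurable_integral_slice _ _ (EFin \o h j.+1)); [exact/measurable_EFinP|move=> x; rewrite lee_fin].
have I0 b : (0 <= \int[rVmeas k]_x (h j.+1 (rcons0 (b, x)))%:E)%E.
  by apply: integral_ge0 => x _; rewrite lee_fin.
have LC b : `[a, (a + 1)%R]%classic b ->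
    (L <= C%:E * \int[rVmeas k]_x (h j.+1 (rcons0 (b, x)))%:E)%E.
  rewrite /= in_itv/= => /andP[ab ba].
  rewrite -ge0_integralZl; [|by []|exact/measurable_EFinP|by move=> x _; rewrite lee_fin|by rewrite lee_fin].
  apply: ge0_le_integral => //.
  - by move=> x _; rewrite lee_fin.
  - exact/measurable_EFinP.
  - by apply: measurable_funeM; exact/measurable_EFinP.
  - move=> x _; rewrite -EFinM lee_fin; apply: hjC => i.
    by apply: close => [|l]; rewrite ?subrr ?normr0// ler_norml; lra.
have : (\int[mu]_(b in `[a, (a + 1)%R]) cst L b <=
    C%:E * \int[rVmeas k.+1]_x (h j.+1 x)%:E)%E.
  rewrite ge0_integral_rV_S; last 2 first.
  - exact/measurable_EFinP.
  - by move=> x; rewrite lee_fin.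
  apply: (@le_trans _ _ (\int[mu]_(b in `[a, (a + 1)%R])
     (C%:E * \int[rVmeas k]_x (h j.+1 (rcons0 (b, x)))%:E))%E).
    apply: ge0_le_integral => //.
    by apply: measurable_funeM; exact: measurable_funTS.
  rewrite ge0_integralZl; [|by []|exact: measurable_funTS|by move=> b _; exact: I0|by rewrite lee_fin].
  by rewrite lee_wpmul2l ?lee_fin//; apply: ge0_subset_integral.
rewrite integral_cst//= lebesgue_measure_itv/= lte_fin ltrDl ltr01 -EFinB (addrC a) addrK mule1.
move=> /le_lt_trans; apply.
by rewrite lte_mul_pinfty// lee_fin.
Qed.

(** Dominated convergence: [C * h 1 (rcons0 (a, x))] majorises all slices of [h 0] at distance at
    most 1 from a. *)
Lemma continuous_slice_integral k (h : nat -> 'rV[R]_k.+1 -> R) :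
  dominated_chain h -> continuous (h 0) ->
  continuous (fun a => \int[rVmeas k]_x h 0 (rcons0 (a, x))).
Proof.
move=> ch c0 a.
have int_h j b : (rVmeas k).-integrable setT (EFin \o (fun x => h j (rcons0 (b, x)))).
  have [mh h0 hoo _] := dominated_chain_slice b ch.
  apply/integrableP; split; first exact/measurable_EFinP.
  by under eq_integral do rewrite /= ger0_norm//.
have [_ h0 _ hC] := ch.
have [C C0 hc] := hC 0.
apply: (@continuity_under_integral _ _ _ _ (fun b x => h 0 (rcons0 (b, x))) setT _ (a - 1) (a + 1) _ _
   (fun x => C * h 1 (rcons0 (a, x)))) => //.
- apply: aeW => x _ b _; apply: (@cvg_comp _ _ _ (fun b : R => rcons0 (b, x)) (h 0)); last exact: c0.
  exact: continuous_rcons0l.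
- exact: (integrableZl measurableT C (int_h 1 a)).
- move=> b; rewrite /= in_itv/= => /andP[ab ba]; apply: aeW => x _.
  rewrite ger0_norm//; apply: hc => i; rewrite !rcons0E.
  by case: unliftP => [l|] _ /=; rewrite ?subrr ?normr0// ler_norml; lra.
- by rewrite inE/= in_itv/=; apply/andP; split; lra.
Qed.

End dominated_chain.

(** The additivity of entropy, written without subtraction. If I or J is infinite the right-hand
    side is; otherwise [ap] and [bp] are finite, and then an infinite [am] or [bm] forces [xm] to be
    infinite. In the remaining cases the claim is linear arithmetic. *)
Lemma combine_entropies (R : realType) (xp xm ap am bp bm I J : \bar R)
    (c1 c2 d1 d2 k1 k2 : R) :
  (0 <= xp)%E -> (0 <= xm)%E -> (0 <= ap)%E -> (0 <= am)%E -> (0 <= bp)%E -> (0 <= bm)%E ->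
  (0 <= I)%E -> (0 <= J)%E ->
  (xp + (am + bm) = xm + (ap + bp) ->
  ap <= I + k1%:E -> bp <= J + k2%:E ->
  ap + c1%:E <= I + am + d1%:E -> bp + c2%:E <= J + bm + d2%:E ->
  xp + (c1 + c2)%:E <= (I + J) + xm + (d1 + d2)%:E)%E.
Proof.
case: I => [I||]//; case: J => [J||]//; case: ap => [ap||]//; case: bp => [bp||]//;
case: am => [am||]//; case: bm => [bm||]//; case: xp => [xp||]//; case: xm => [xm||]//=;
rewrite -?EFinD ?lee_fin ?addye ?addey ?leey//.
move=> _ _ _ _ _ _ _ _ [e] h1 h2 h3 h4; lra.
Qed.

(** * The log-Sobolev inequality by tensorization *)

Section log_sobolev.
Context {R : realType}.
Variable t : R.
Hypothesis t0 : 0 < t.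
Notation mu := (@lebesgue_measure R).

(** The contribution of one coordinate to the final constant. Its positive and negative parts go to
    opposite sides, so that all integrands are nonnegative. *)
Let cst1 : R := 1 + ln (4 * pi * t) / 2.
Let cp : R := Num.max cst1 0.
Let cm : R := Num.max (- cst1) 0.

Let cp0 : 0 <= cp. Proof. by rewrite le_max lexx orbT. Qed.
Let cm0 : 0 <= cm. Proof. by rewrite le_max lexx orbT. Qed.
Let cpm : cp - cm = cst1.
Proof. by rewrite /cp /cm /Num.max; case: ifPn; case: ifPn; rewrite -?leNgt; lra. Qed.

(** A crude constant that serves to make positive parts finite; the first summand is the bound on
    the second moment of T, divided by 4t. *)
Let K1 : R := (4 * t)^-1 * transport_const t + cm.

Let pos_neg (r : R) : Num.max r 0 - Num.max (- r) 0 = r.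
Proof. by rewrite /Num.max; case: ifPn; case: ifPn; rewrite -?leNgt; lra. Qed.

Let max_ge0 (r : R) : 0 <= Num.max r 0.
Proof. by rewrite le_max lexx orbT. Qed.

Let ln_gdens z : ln (gdens t z) = 1 - cst1 - z ^+ 2 / (4 * t).
Proof.
have s0 : 0 < 4 * pi * t by rewrite !mulr_gt0 ?pi_gt0.
rewrite /gdens lnM ?posrE ?invr_gt0 ?sqrtr_gt0 ?expR_gt0// expRK lnV ?posrE ?sqrtr_gt0//.
by rewrite -powR12_sqrt ?ltW// ln_powR /cst1 mulNr; field; rewrite gt_eqF.
Qed.

Section one_dimensional.
Variables (k : nat) (f D : 'rV[R]_k.+1 -> R) (p : R -> R) (M : R).
Hypotheses (f0 : forall x, 0 < f x) (cf : continuous f) (cD : continuous D).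
Hypothesis dfD : forall x (b : R),
  is_derive b 1 (fun b => f (x + b *: delta_mx ord0 ord0)) (D (x + b *: delta_mx ord0 ord0)).
Hypotheses (cp' : continuous p) (p0 : forall a, 0 < p a)
  (pE : forall a, (\int[rVmeas k]_x (f (rcons0 (a, x)))%:E = (p a)%:E)%E)
  (pM : (\int[mu]_a (p a)%:E = M%:E)%E).

Let B a := p a * (ln (p a) - ln M).
Let J : \bar R := (t%:E * \int[rVmeas k.+1]_x (D x ^+ 2 / f x)%:E)%E.

Lemma marginal_entropy :
  (\int[mu]_a (Num.max (B a) 0)%:E <= J + (K1 * M)%:E)%E /\
  (\int[mu]_a (Num.max (B a) 0)%:E + (cp * M)%:E <=
    J + \int[mu]_a (Num.max (- B a) 0)%:E + (cm * M)%:E)%E.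
Proof.
have [T [dT [dTP cdT dT0 TE [Tl Ts TQ]]]] := transport_exists t0 cp' p0 pM.
have M0 : 0 < M by apply: le_lt_trans (cdf_of_ltM cp' p0 pM 0); exact: cdf_of_ge0.
have := energy_ineq f0 cf cD dfD cp' pE t0 dTP cdT dT0 Tl Ts TQ.
rewrite -/J; set W := (\int[mu]_a (dT a * p a)%:E)%E.
set Q := (\int[mu]_a (T a ^+ 2 * p a)%:E)%E => WJ.
have cT : continuous T by move=> a; exact: der_continuous (dTP a).
have Q0 : (0 <= Q)%E by apply: integral_ge0 => a _; rewrite lee_fin mulr_ge0 ?sqr_ge0 ?ltW.
have Qfin : Q \is a fin_num by rewrite ge0_fin_numE// (le_lt_trans TQ)// ltry.
have t40 : 0 <= (4 * t)^-1 by rewrite invr_ge0 mulr_ge0// ltW.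
(* ln p - ln M = ln g(T) + ln T', with ln T' <= T' - 1; the 1 in [ln_gdens] cancels the -1. *)
have BT a : B a <= p a * dT a - p a * cst1 - (4 * t)^-1 * (T a ^+ 2 * p a).
  have h : ln (p a) - ln M <= (dT a - 1) + (1 - cst1 - T a ^+ 2 / (4 * t)).
    have -> : ln (p a) = ln M + ln (gdens t (T a)) + ln (dT a).
      have g0 := gdens_gt0 (T a) t0.
      by rewrite TE (@lnM _ (M * gdens t (T a))) ?posrE ?(mulr_gt0 M0)// (@lnM _ M) ?posrE.
    rewrite ln_gdens.
    have := @le_ln1Dx R (dT a - 1); rewrite (addrC 1) subrK => /(_ _).
    have -> : -1 < dT a - 1 by have := dT0 a; lra.
    by move=> /(_ isT); lra.
  rewrite (le_trans (ler_wpM2l (ltW (p0 a)) h))// le_eqVlt; apply/orP; left; apply/eqP; ring.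
have mp : measurable_fun setT p by exact: continuous_measurable_fun.
have mB : measurable_fun setT B.
  apply: measurable_funM => //; apply: measurable_funB => //.
  by apply: measurableT_comp => //; exact: measurable_ln.
have mdT : measurable_fun setT dT by exact: continuous_measurable_fun.
have mT2 : measurable_fun setT (fun a => T a ^+ 2).
  by apply: measurable_funX; exact: continuous_measurable_fun.
have mmax (g : R -> R) : measurable_fun setT g -> measurable_fun setT (fun a : R => (Num.max (g a) 0)%:E).
  by move=> mg; apply/measurable_EFinP; apply: measurable_maxr.
have mNB : measurable_fun setT (fun a => - B a) by exact: measurableT_comp.
have mW : measurable_fun setT (fun a => (dT a * p a)%:E).
  by apply/measurable_EFinP; exact: measurable_funM.
have mQ : measurable_fun setT (fun a => ((4 * t)^-1%:E * (T a ^+ 2 * p a)%:E)%E).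
  by apply: measurable_funeM; apply/measurable_EFinP; exact: measurable_funM.
have mc c : measurable_fun setT (fun a => (c%:E * (p a)%:E)%E).
  by apply: measurable_funeM; exact/measurable_EFinP.
have pc c : 0 <= c -> (\int[mu]_a (c%:E * (p a)%:E) = (c * M)%:E)%E.
  move=> c0; rewrite ge0_integralZl; [by rewrite pM|by []|exact/measurable_EFinP| |by rewrite lee_fin].
  by move=> a _; rewrite lee_fin ltW.
have QE : (\int[mu]_a ((4 * t)^-1%:E * (T a ^+ 2 * p a)%:E) = (4 * t)^-1%:E * Q)%E.
  rewrite ge0_integralZl; [by []|by []| | |by rewrite lee_fin].
  - by apply/measurable_EFinP; exact: measurable_funM.
  - by move=> a _; rewrite lee_fin mulr_ge0 ?sqr_ge0 ?ltW.
have dTp0 a : 0 <= dT a * p a by rewrite mulr_ge0 ?ltW.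
have Tp0 a : 0 <= (4 * t)^-1 * (T a ^+ 2 * p a) by rewrite mulr_ge0// mulr_ge0 ?sqr_ge0 ?ltW.
have cst1m : - cst1 <= cm by rewrite le_max lexx.
split.
  apply: (@le_trans _ _ (W + (cm * M)%:E)%E).
    rewrite -pc// -ge0_integralD; [|by []|by move=> a _; rewrite lee_fin|by []
      |by move=> a _; rewrite -EFinM lee_fin mulr_ge0// ltW|exact: mc].
    apply: ge0_le_integral; [by []| | | |].
    - by move=> a _; rewrite lee_fin.
    - exact: mmax.
    - by apply: emeasurable_funD => //; exact: mc.
    - move=> a _; rewrite -EFinM -EFinD lee_fin ge_max addr_ge0 ?mulr_ge0 ?(ltW (p0 _)) ?(ltW (dT0 _))// andbT.
      have := BT a; have := Tp0 a; have := ler_wpM2l (ltW (p0 a)) cst1m; lra.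
  apply: (@le_trans _ _ (J + (4 * t)^-1%:E * Q + (cm * M)%:E)%E).
    by rewrite leeD2r.
  have -> : (K1 * M)%:E = ((4 * t)^-1%:E * (M * transport_const t)%:E + (cm * M)%:E)%E.
    by rewrite -EFinM -EFinD; congr EFin; rewrite /K1; ring.
  by rewrite addeA leeD2r// leeD2l// lee_wpmul2l// lee_fin.
have mMB := mmax _ mB; have mMN := mmax _ mNB.
have L : (\int[mu]_a (Num.max (B a) 0)%:E + (cp * M)%:E + (4 * t)^-1%:E * Q <=
    \int[mu]_a (Num.max (- B a) 0)%:E + (cm * M)%:E + W)%E.
  have n1 a : (0 <= (Num.max (B a) 0)%:E)%E by rewrite lee_fin.
  have n2 a : (0 <= (Num.max (- B a) 0)%:E)%E by rewrite lee_fin.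
  have n3 c a : 0 <= c -> (0 <= c%:E * (p a)%:E)%E.
    by move=> c0; rewrite -EFinM lee_fin mulr_ge0// ltW.
  have n4 a : (0 <= (4 * t)^-1%:E * (T a ^+ 2 * p a)%:E)%E by rewrite -EFinM lee_fin.
  have n5 a : (0 <= (dT a * p a)%:E)%E by rewrite lee_fin.
  rewrite -QE -(pc cp)// -(pc cm)//.
  rewrite -ge0_integralD; [|by []|by move=> a _|by []|by move=> a _; exact: n3|exact: mc].
  rewrite -ge0_integralD; [|by []|by move=> a _; rewrite adde_ge0// n3
    |by apply: emeasurable_funD => //; exact: mc|by move=> a _; exact: n4|by []].
  rewrite -ge0_integralD; [|by []|by move=> a _|by []|by move=> a _; exact: n3|exact: mc].
  rewrite -ge0_integralD; [|by []|by move=> a _; rewrite adde_ge0// n3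
    |by apply: emeasurable_funD => //; exact: mc|by move=> a _; exact: n5|by []].
  apply: ge0_le_integral; [by []| | | |].
  - by move=> a _; rewrite adde_ge0 ?n4// adde_ge0// n3.
  - by apply: emeasurable_funD => //; apply: emeasurable_funD => //; exact: mc.
  - by apply: emeasurable_funD => //; apply: emeasurable_funD => //; exact: mc.
  - move=> a _; rewrite -!EFinM -!EFinD lee_fin.
    have := pos_neg (B a); have := BT a; rewrite -cpm; lra.
(* The second moment occurs with the same factor 1/(4t) in the pointwise bound and in [energy_ineq];
   being finite, it cancels. *)
rewrite -(@leeD2rE _ ((4 * t)^-1%:E * Q)%E); last by rewrite fin_numM.
rewrite (le_trans L)//.
have AC (x y z w : \bar R) : (x + y + z + w = y + z + (x + w))%E.
  by rewrite [RHS]addeCA !addeA.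
by rewrite [leRHS]AC leeD2l.
Qed.

End one_dimensional.

Let K10 : 0 <= K1.
Proof.
have t20 : 0 <= (4 * t)^-1 by rewrite invr_ge0 mulr_ge0// ltW.
rewrite addr_ge0// mulr_ge0// /transport_const !mulr_ge0 ?pi_ge0 ?invr_ge0 ?sqrtr_ge0//.
by rewrite addr_ge0// mulr_ge0 ?sqr_ge0// ltW.
Qed.

(** If a positive function had integral 0, the whole space would be a null set, against the unit
    mass of the heat kernel. *)
Let integral_gt0 k (f : 'rV[R]_k -> R) (p : R) : measurable_fun setT f ->
  (forall x, 0 < f x) -> (\int[rVmeas k]_x (f x)%:E = p%:E)%E -> 0 < p.
Proof.
move=> mf f0 fp; rewrite lt_neqAle; apply/andP; split; last first.
  by rewrite -lee_fin -fp; apply: integral_ge0 => x _; rewrite lee_fin ltW.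
apply/negP => /eqP p0.
have me : measurable_fun setT (EFin \o f) by exact/measurable_EFinP.
have /(ae_eq_integral_abs _ measurableT me) f_ae : (\int[rVmeas k]_x `|(EFin \o f) x| = 0)%E.
  under eq_integral do rewrite /= ger0_norm ?(ltW (f0 _))//.
  by rewrite fp -p0.
have h_ae : ae_eq (rVmeas k) setT (EFin \o @heat R k 1 0) (cst 0%E).
  case: f_ae => N [mN N0 sN]; exists N; split => // x _; apply: sN => /(_ I) [fx].
  by have := f0 x; rewrite fx ltxx.
have mh : measurable_fun setT (EFin \o @heat R k 1 0).
  by apply/measurable_EFinP; exact: measurable_heat.
have := @integral_heat R k 1 0 ltr01.
have -> : (\int[rVmeas k]_x (@heat R k 1 0 x)%:E = \int[rVmeas k]_x (cst 0%E x))%E.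
  by apply: ae_eq_integral.
by rewrite integral0 => /eqP; rewrite eqe eq_sym oner_eq0.
Qed.

(* The first inequality makes the positive part finite when the Fisher information
   is, so that the second one can be rearranged without [oo - oo]. *)
Lemma entropy_fisher k (h : nat -> 'rV[R]_k -> R) (D : 'I_k -> 'rV[R]_k -> R) (M : R) :
  dominated_chain h -> continuous (h 0) -> (forall x, 0 < h 0 x) ->
  (forall i, continuous (D i)) ->
  (forall i x (b : R), is_derive b 1 (fun b => h 0 (x + b *: delta_mx ord0 i))
     (D i (x + b *: delta_mx ord0 i))) ->
  (\int[rVmeas k]_x (h 0 x)%:E = M%:E)%E ->
  let A x := h 0 x * (ln (h 0 x) - ln M) in
  let I := (t%:E * \sum_(i < k) \int[rVmeas k]_x (D i x ^+ 2 / h 0 x)%:E)%E in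
  (\int[rVmeas k]_x (Num.max (A x) 0)%:E <= I + (k%:R * K1 * M)%:E)%E /\
  (\int[rVmeas k]_x (Num.max (A x) 0)%:E + (k%:R * cp * M)%:E <=
    I + \int[rVmeas k]_x (Num.max (- A x) 0)%:E + (k%:R * cm * M)%:E)%E.
Proof.
elim: k h D M => [|k IH] h D M ch c0 f0 cD dfD fM A I.
  (* In dimension 0 the measure is a point mass, so M is the value of the function and the entropy
     is 0. *)
  have hM : M = h 0 0.
    apply: EFin_inj; rewrite -fM [LHS]integral_dirac// ?diracT ?mul1e//.
    by apply/measurable_EFinP; exact: continuous_rV_measurable.
  have A0 x : A x = 0 by rewrite /A hM (_ : x = 0) ?subrr ?mulr0//; apply/rowP => -[].
  have I0 : I = 0%E by rewrite /I big_ord0 mule0.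
  under eq_integral do rewrite A0 maxxx.
  under [X in _ /\ (_ <= _ + X + _)%E]eq_integral do rewrite A0 oppr0 maxxx.
  by rewrite !integral0 I0 !mul0r !add0e.
set f := h 0 in c0 f0 dfD fM A I *.
have mf : measurable_fun setT f by exact: continuous_rV_measurable.
have chS a := dominated_chain_slice a ch.
pose p a := \int[rVmeas k]_x f (rcons0 (a, x)).
have cpp : continuous p by exact: continuous_slice_integral.
have pE a : (\int[rVmeas k]_x (f (rcons0 (a, x)))%:E = (p a)%:E)%E.
  have [mh h0 hoo _] := chS a.
  rewrite /p /Rintegral fineK// ge0_fin_numE; first exact: (hoo 0).
  by apply: integral_ge0 => x _; rewrite lee_fin ltW.
have mfS a : measurable_fun setT (fun x : 'rV[R]_k => f (rcons0 (a, x))).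
  by have [mh _ _ _] := chS a; exact: (mh 0).
have p0 a : 0 < p a by exact: integral_gt0 (mfS a) (fun x => f0 _) (pE a).
have pM : (\int[mu]_a (p a)%:E = M%:E)%E.
  rewrite -fM ge0_integral_rV_S.
  - by apply: eq_integral => a _; rewrite pE.
  - exact/measurable_EFinP.
  - by move=> x; rewrite lee_fin ltW.
have M0 : 0 < M by exact: integral_gt0 mf f0 fM.
have [b1 b2] := marginal_entropy f0 c0 (cD ord0) (dfD ord0) cpp p0 pE pM.
(* Chain rule ln (f/M) = ln (f/p) + ln (p/M): [A'] is the relative entropy of the slices, left to
   the induction, and [B'] that of the marginal. *)
pose A' (x : 'rV[R]_k.+1) := f x * (ln (f x) - ln (p (x ord0 ord0))).
pose B' (x : 'rV[R]_k.+1) := f x * (ln (p (x ord0 ord0)) - ln M).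
have mlnf : measurable_fun setT (fun x => ln (f x)).
  by apply: measurableT_comp => //; exact: measurable_ln.
have mlnp : measurable_fun setT (fun a => ln (p a)).
  by apply: measurableT_comp; [exact: measurable_ln|exact: continuous_measurable_fun].
have mlnp0 : measurable_fun setT (fun x : 'rV[R]_k.+1 => ln (p (x ord0 ord0))).
  by apply: (measurableT_comp mlnp); exact: measurable_coord.
have mA' : measurable_fun setT A' by apply: measurable_funM => //; exact: measurable_funB.
have mB' : measurable_fun setT B' by apply: measurable_funM => //; exact: measurable_funB.
have mA : measurable_fun setT A by apply: measurable_funM => //; exact: measurable_funB.
have mmax (g : 'rV[R]_k.+1 -> R) : measurable_fun setT g ->
    measurable_fun setT (fun x => (Num.max (g x) 0)%:E).
  by move=> mg; apply/measurable_EFinP; exact: measurable_maxr.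
have mmaxN (g : 'rV[R]_k.+1 -> R) : measurable_fun setT g ->
    measurable_fun setT (fun x => (Num.max (- g x) 0)%:E).
  by move=> mg; apply: (mmax (fun x => - g x)); exact: measurableT_comp.
have max0 (r : R) : (0 <= (Num.max r 0)%:E)%E by rewrite lee_fin.
have fmax (r c : R) : 0 < c -> Num.max (c * r) 0 = Num.max r 0 * c.
  by move=> c00; rewrite mulrC maxr_pMl ?ltW// mul0r.
(* The sign s is 1 or -1, so that one computation covers the positive and the negative part. *)
pose w (s : R) a := Num.max (s * (ln (p a) - ln M)) 0.
have mw s : measurable_fun setT (w s).
  apply: measurable_maxr => //; apply: measurable_funM => //; exact: measurable_funB.
have bE s : (\int[rVmeas k.+1]_x (Num.max (s * B' x) 0)%:E =
    \int[mu]_a (Num.max (s * (p a * (ln (p a) - ln M))) 0)%:E)%E.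
  transitivity (\int[rVmeas k.+1]_x (w s (x ord0 ord0) * f x)%:E)%E.
    by apply: eq_integral => x _; rewrite /B' /w mulrCA (fmax _ (f x)).
  rewrite (integral_rV_weighted mf (fun x => ltW (f0 x)) pE (mw s)); last by move=> a; exact: max_ge0.
  by apply: eq_integral => a _; rewrite /w (mulrCA s (p a)) (fmax _ (p a)).
have bpE : (\int[rVmeas k.+1]_x (Num.max (B' x) 0)%:E =
    \int[mu]_a (Num.max (p a * (ln (p a) - ln M)) 0)%:E)%E.
  by have := bE 1; under eq_integral do rewrite mul1r;
     under [in X in _ = X]eq_integral do rewrite mul1r.
have bmE : (\int[rVmeas k.+1]_x (Num.max (- B' x) 0)%:E =
    \int[mu]_a (Num.max (- (p a * (ln (p a) - ln M))) 0)%:E)%E.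
  by have := bE (-1); under eq_integral do rewrite mulN1r;
     under [in X in _ = X]eq_integral do rewrite mulN1r.
rewrite -bpE in b1; rewrite -bpE -bmE in b2.
have ge0I (g : 'rV[R]_k.+1 -> R) : (0 <= \int[rVmeas k.+1]_x (Num.max (g x) 0)%:E)%E.
  by apply: integral_ge0 => x _.
pose I' := (t%:E * \sum_(j < k) \int[rVmeas k.+1]_x (D (lift ord0 j) x ^+ 2 / f x)%:E)%E.
pose J := (t%:E * \int[rVmeas k.+1]_x (D ord0 x ^+ 2 / f x)%:E)%E.
have fish0 i x : 0 <= D i x ^+ 2 / f x by rewrite divr_ge0 ?sqr_ge0// ltW.
have mfish i : measurable_fun setT (fun x => (D i x ^+ 2 / f x)%:E).
  apply/measurable_EFinP; apply: continuous_rV_measurable => x.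
  apply: (@cvgM _ _ (nbhs x)).
    by apply: (@cvg_comp _ _ _ (D i) (fun r => r ^+ 2)); [exact: cD|exact: exprn_continuous].
  by apply: (@cvgV _ _ (nbhs x)); [rewrite gt_eqF|exact: c0].
have Fi0 i : (0 <= \int[rVmeas k.+1]_x (D i x ^+ 2 / f x)%:E)%E.
  by apply: integral_ge0 => x _; rewrite lee_fin.
have t1 : (0 <= t%:E)%E by rewrite lee_fin ltW.
have I'0 : (0 <= I')%E by rewrite mule_ge0// sume_ge0.
have J0 : (0 <= J)%E by rewrite mule_ge0.
have IE : I = (I' + J)%E.
  by rewrite /I big_ord_recl ge0_muleDr ?sume_ge0// addeC.
have fDS a j x (b : R) : is_derive b 1 (fun b => f (rcons0 (a, x + b *: delta_mx ord0 j)))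
     (D (lift ord0 j) (rcons0 (a, x + b *: delta_mx ord0 j))).
  have := dfD (lift ord0 j) (rcons0 (a, x)) b; rewrite rcons0_lineS.
  by congr (is_derive b 1 _ _); apply/funext => c; rewrite rcons0_lineS.
have cS (g : 'rV[R]_k.+1 -> R) a : continuous g -> continuous (fun x => g (rcons0 (a, x))).
  move=> cg x; apply: (@cvg_comp _ _ _ (fun y => rcons0 (a, y)) g); last exact: cg.
  exact: continuous_rcons0r.
(* The slice at a has mass [p a], and so [ln (p a)] takes the place of ln M. *)
have IHa a := IH (fun j x => h j (rcons0 (a, x))) (fun j x => D (lift ord0 j) (rcons0 (a, x)))
  (p a) (chS a) (cS _ a c0) (fun x => f0 _) (fun j => cS _ a (cD (lift ord0 j))) (fDS a) (pE a).
pose S a := (t%:E * \sum_(j < k) \int[rVmeas k]_x (D (lift ord0 j) (rcons0 (a, x)) ^+ 2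
    / f (rcons0 (a, x)))%:E)%E.
have mSj j : measurable_fun [set: measurableTypeR R]
   (fun a => \int[rVmeas k]_x (D (lift ord0 j) (rcons0 (a, x)) ^+ 2 / f (rcons0 (a, x)))%:E)%E.
  apply: (@measurable_integral_slice _ _ (fun x => (D (lift ord0 j) x ^+ 2 / f x)%:E)) => //.
  by move=> x; rewrite lee_fin.
have Sj0 j a : (0 <= \int[rVmeas k]_x (D (lift ord0 j) (rcons0 (a, x)) ^+ 2 / f (rcons0 (a, x)))%:E)%E.
  by apply: integral_ge0 => x _; rewrite lee_fin.
have mS : measurable_fun [set: measurableTypeR R] S.
  by apply: measurable_funeM; exact: emeasurable_sum.
have S0 a : (0 <= S a)%E by rewrite mule_ge0// sume_ge0.
have SI : (\int[mu]_a S a = I')%E.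
  rewrite /S ge0_integralZl; [|by []|exact: emeasurable_sum|by move=> a _; rewrite sume_ge0|by []].
  congr (_ * _)%E; rewrite ge0_integral_sum//.
  apply: eq_bigr => j _; rewrite ge0_integral_rV_S//.
  by move=> x; rewrite lee_fin.
have slice_max (g : 'rV[R]_k.+1 -> R) : measurable_fun setT g ->
  (\int[rVmeas k.+1]_x (Num.max (g x) 0)%:E =
   \int[mu]_a \int[rVmeas k]_x (Num.max (g (rcons0 (a, x))) 0)%:E)%E.
  by move=> mg; rewrite ge0_integral_rV_S//; exact: mmax.
have m_slice (g : 'rV[R]_k.+1 -> R) : measurable_fun setT g ->
  measurable_fun [set: measurableTypeR R] (fun a => \int[rVmeas k]_x (Num.max (g (rcons0 (a, x))) 0)%:E)%E.
  move=> mg; apply: (@measurable_integral_slice _ _ (fun x => (Num.max (g x) 0)%:E)) => //.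
  exact: mmax.
have slice0 (g : 'rV[R]_k.+1 -> R) a : (0 <= \int[rVmeas k]_x (Num.max (g (rcons0 (a, x))) 0)%:E)%E.
  by apply: integral_ge0 => x _.
have mNA' : measurable_fun setT (fun x => - A' x) by exact: measurableT_comp.
have pc (c : R) : 0 <= c -> (\int[mu]_a (c * p a)%:E = (c * M)%:E)%E.
  move=> c00; under eq_integral do rewrite EFinM.
  rewrite ge0_integralZl; [by rewrite pM|by []| | |by rewrite lee_fin].
    by apply/measurable_EFinP; exact: continuous_measurable_fun.
  by move=> a _; rewrite lee_fin ltW.
have mpc (c : R) : measurable_fun setT (fun a => (c * p a)%:E).
  by apply/measurable_EFinP/measurable_funM => //; exact: continuous_measurable_fun.
have pc0 (c : R) a : 0 <= c -> (0 <= (c * p a)%:E)%E.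
  by move=> c00; rewrite lee_fin mulr_ge0// ltW.
have kK : 0 <= k%:R * K1 by rewrite mulr_ge0.
have kcp : 0 <= k%:R * cp by rewrite mulr_ge0.
have kcm : 0 <= k%:R * cm by rewrite mulr_ge0.
have A'E a x : A' (rcons0 (a, x)) = f (rcons0 (a, x)) * (ln (f (rcons0 (a, x))) - ln (p a)).
  by rewrite /A' rcons0_0.
have a1 : (\int[rVmeas k.+1]_x (Num.max (A' x) 0)%:E <= I' + (k%:R * K1 * M)%:E)%E.
  rewrite -SI -pc// -ge0_integralD; [|by []|by move=> a _|by []|by move=> a _; exact: pc0|exact: mpc].
  rewrite slice_max//; apply: ge0_le_integral; [by []|by move=> a _|exact: m_slice| |].
    by apply: emeasurable_funD => //; exact: mpc.
  move=> a _; under eq_integral do rewrite A'E.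
  by have [] := IHa a.
have a2 : (\int[rVmeas k.+1]_x (Num.max (A' x) 0)%:E + (k%:R * cp * M)%:E <=
    I' + \int[rVmeas k.+1]_x (Num.max (- A' x) 0)%:E + (k%:R * cm * M)%:E)%E.
  rewrite (slice_max _ mA') (slice_max _ mNA') -SI -(pc _ kcp) -(pc _ kcm).
  have mA'S := m_slice _ mA'; have mNA'S := m_slice _ mNA'.
  rewrite -ge0_integralD; [|by []|by move=> a _|by []|by move=> a _; exact: pc0|exact: mpc].
  rewrite -ge0_integralD; [|by []|by move=> a _|by []|by move=> a _; exact: (slice0 (fun x => - A' x))|by []].
  rewrite -ge0_integralD; [|by []
    |by move=> a _; apply: adde_ge0 => //; exact: (slice0 (fun x => - A' x))
    |exact: emeasurable_funD|by move=> a _; exact: pc0|exact: mpc].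
  apply: ge0_le_integral; [by []|by move=> a _; apply: adde_ge0 => //; exact: pc0| | |].
  - by apply: emeasurable_funD => //; exact: mpc.
  - by apply: emeasurable_funD; [exact: emeasurable_funD|exact: mpc].
  - move=> a _; under eq_integral do rewrite A'E.
    under [X in (_ <= _ + X + _)%E]eq_integral do rewrite A'E.
    by have [] := IHa a.
have AE x : A x = A' x + B' x by rewrite /A /A' /B'; ring.
have kS (c : R) : k.+1%:R * c * M = k%:R * c * M + c * M by rewrite -natr1; ring.
split.
  rewrite IE kS EFinD.
  apply: (@le_trans _ _ (\int[rVmeas k.+1]_x (Num.max (A' x) 0)%:E
     + \int[rVmeas k.+1]_x (Num.max (B' x) 0)%:E)%E).
    rewrite -ge0_integralD; [|by []|by move=> x _|exact: mmax|by move=> x _|exact: mmax].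
    apply: ge0_le_integral; [by []|by move=> x _|exact: mmax| |].
      by apply: emeasurable_funD; exact: mmax.
    move=> x _; rewrite -EFinD lee_fin AE ge_max addr_ge0// andbT.
    by rewrite lerD// le_max lexx.
  by rewrite [leRHS]addeACA; apply: leeD.
rewrite IE !kS.
apply: (combine_entropies (ge0I _) (ge0I (fun x => - A x)) (ge0I _) (ge0I (fun x => - A' x))
  (ge0I _) (ge0I (fun x => - B' x)) I'0 J0 _ a1 b1 a2 b2).
have D2 g1 g2 := @ge0_integralD _ _ _ (rVmeas k.+1) setT measurableT g1 g2.
rewrite -!D2//; try by [move=> x _; rewrite adde_ge0|exact: mmax|exact: mmaxN|apply: emeasurable_funD; (exact: mmax || exact: mmaxN)].
apply: eq_integral => x _; rewrite -!EFinD; congr EFin.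
have := pos_neg (A x); have := pos_neg (A' x); have := pos_neg (B' x); rewrite AE; lra.
Qed.

End log_sobolev.

Section line_derivatives.
Context {R : realType} {V : normedModType R}.

Lemma is_derive_line (g : V -> R) (x v : V) (b : R) :
  differentiable g (x + b *: v) ->
  is_derive b 1 (fun b => g (x + b *: v)) ('D_v g (x + b *: v)).
Proof.
move=> dg; have dgv := diff_derivable dg (v := v).
have e : (fun h : R => h^-1 *: (((fun b => g (x + b *: v)) \o shift b) (h *: (1 : R)) - g (x + b *: v)))
    = (fun h : R => h^-1 *: ((g \o shift (x + b *: v)) (h *: v) - g (x + b *: v))).
  apply/funext => h /=; congr (_ *: (g _ - _)).
  by rewrite (_ : h *: (1 : R) = h) ?scalerDl 1?addrCA//; exact: mulr1.
split; first by rewrite /derivable e.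
by rewrite /derive e.
Qed.

End line_derivatives.

(** * Comparison of heat kernels at nearby points *)

Section harnack.
Context {R : realType} (n : nat).

(** From |w - y|^2 <= 2 |w - x|^2 + 2n. Doubling the time halves the exponent and absorbs the factor
    2; what is left over is n/(4s), and the normalisation costs the power of the square root of
    2. *)
Lemma heat_harnack (s : R) (x y w : 'rV[R]_n) : 0 < s ->
  (forall i, `|x ord0 i - y ord0 i| <= 1) ->
  heat s x w <= Num.sqrt 2 ^+ n * expR (n%:R / (4 * s)) * heat (2 * s) y w.
Proof.
move=> s0 xy.
have q : sqn (w - y) <= 2 * sqn (w - x) + 2 * n%:R.
  have -> : 2 * n%:R = \sum_(i < n) 2 :> R by rewrite sumr_const card_ord mulr_natr.
  rewrite /sqn mulr_sumr -big_split/=; apply: ler_sum => i _; rewrite !mxE.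
  have := xy i; rewrite -[X in _ -> _ <= _ + X]mulr1.
  move: (w ord0 i) (x ord0 i) (y ord0 i) => c a b ab.
  have : (a - b) ^+ 2 <= 1 by rewrite -real_normK ?num_real// exprn_ile1.
  have : 0 <= ((c - a) - (a - b)) ^+ 2 by exact: sqr_ge0.
  move=> h1 h2; nra.
rewrite /heat heat_norm_double// -[leLHS]mulrA -[leRHS]mulrA ler_wpM2l ?exprn_ge0 ?sqrtr_ge0//.
rewrite [leRHS]mulrCA ler_wpM2l ?exprn_ge0 ?invr_ge0 ?sqrtr_ge0// -expRD ler_expR.
rewrite (_ : - sqn (w - y) / (4 * (2 * s)) = - (sqn (w - y) / 2) / (4 * s)); last by field; rewrite gt_eqF.
by rewrite -mulrDl ler_pM2r ?invr_gt0 ?mulr_gt0//; lra.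
Qed.

End harnack.

Theorem theorem1p2 (R : realType) (n : nat) (u : 'rV[R]_n -> R -> R) :
  (0 < n)%N ->
  (* smooth on R^n x (0,oo), continuous up to t = 0 *)
  smooth_on [set p : 'rV[R]_n * R | 0 < p.2] (uncurry_st u) ->
  {within [set p : 'rV[R]_n * R | 0 <= p.2], continuous (uncurry_st u)} ->
  (* positivity *)
  (forall x t, 0 <= t -> 0 < u x t) ->
  (* heat equation d_t u = Laplacian_x u *)
  (forall x t, 0 < t ->
     'D_dir_t (uncurry_st u) (x, t) =
     \sum_(i < n) 'D_(dir_x i) ('D_(dir_x i) (uncurry_st u)) (x, t)) ->
  (* u, d_t u, d_t^2 u bounded *)
  (exists M, forall x t, 0 <= t -> `|u x t| <= M) ->
  (exists M, forall x t, 0 < t -> `|'D_dir_t (uncurry_st u) (x, t)| <= M) ->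
  (exists M, forall x t, 0 < t ->
     `|'D_dir_t ('D_dir_t (uncurry_st u)) (x, t)| <= M) ->
  (forall (tau : R) (ybar : forall N : nat, 'rV[R]_N),
     0 < tau ->
     (forall N : nat, (3 <= N)%N -> enorm (ybar N) = Num.sqrt (2 * N%:R * tau)) ->
     (fun N : nat =>
        ((Num.sqrt (2 * N%:R * tau)) `^ ((n + N)%:R - 2)
         * vfun u 0 (ybar N))%:E)
       @ \oo -->
     (((4 * pi) `^ (- (n%:R / 2)))%:E
       * int_Rn (fun x : 'rV[R]_n => (u x 0 * expR (- (enorm x ^+ 2 / (4 * tau))))%:E))%E)
  /\
  ((forall t, 0 <= t -> int_Rn (fun x : 'rV[R]_n => (u x t)%:E) = 1%E) ->
   forall t, 0 < t ->
     ((n%:R + n%:R / 2 * ln (4 * pi))%:E <= Wfun u t)%E).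
Proof.
move=> _ smooth cont0 u0 heat_eq [M uM] [M1 utM] _.
set U := uncurry_st u in smooth cont0 heat_eq utM *.
have dU (p : 'rV[R]_n * R) : 0 < p.2 -> differentiable U p.
  by have [+ _] := smooth 1; exact.
have dU1 w (p : 'rV[R]_n * R) : 0 < p.2 -> differentiable ('D_w U) p.
  by move=> p2; have [_ /(_ w)[+ _]] := smooth 2; exact.
have dU2 w v (p : 'rV[R]_n * R) : 0 < p.2 -> differentiable ('D_v ('D_w U)) p.
  by move=> p2; have [_ /(_ w)[_ /(_ v)[+ _]]] := smooth 3; exact.
have lineT (x : 'rV[R]_n) (s : R) : (x, s) = (x, 0) + s *: dir_t :> 'rV[R]_n * R.
  by congr pair; rewrite /= ?scaler0 ?addr0// /GRing.scale/= mulr1 add0r.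
have lineX (x : 'rV[R]_n) (s b : R) i : (x + b *: delta_mx ord0 i, s) = (x, s) + b *: dir_x i :> 'rV[R]_n * R.
  by congr pair; rewrite /= /GRing.scale/= mulr0 addr0.
have dut x (s : R) : 0 < s -> is_derive s 1 (u x) ('D_dir_t U (x, s)).
  move=> s0; have := @is_derive_line _ _ U (x, 0) dir_t s.
  rewrite -lineT => /(_ (dU (x, s) s0)); congr (is_derive s 1 _ _).
  by apply/funext => r; rewrite -lineT.
have du1 i x (s b : R) : 0 < s ->
    is_derive b 1 (fun b => u (x + b *: delta_mx ord0 i) s)
      ('D_(dir_x i) U (x + b *: delta_mx ord0 i, s)).
  move=> s0; have := @is_derive_line _ _ U (x, s) (dir_x i) b.
  rewrite -lineX => /(_ (dU (x + b *: delta_mx ord0 i, s) s0)); congr (is_derive b 1 _ _).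
  by apply/funext => r; rewrite -lineX.
have du2 i x (s b : R) : 0 < s ->
    is_derive b 1 (fun b => 'D_(dir_x i) U (x + b *: delta_mx ord0 i, s))
      ('D_(dir_x i) ('D_(dir_x i) U) (x + b *: delta_mx ord0 i, s)).
  move=> s0; have := @is_derive_line _ _ ('D_(dir_x i) U) (x, s) (dir_x i) b.
  rewrite -lineX => /(_ (dU1 (dir_x i) (x + b *: delta_mx ord0 i, s) s0)); congr (is_derive b 1 _ _).
  by apply/funext => r; rewrite -lineX.
have cX (g : 'rV[R]_n * R -> R) (s : R) : (forall p : 'rV[R]_n * R, 0 < p.2 -> differentiable g p) -> 0 < s ->
    continuous (fun x : 'rV[R]_n => g (x, s)).
  move=> dg s0 x; apply: (@cvg_comp _ _ _ (fun y : 'rV[R]_n => (y, s)) g _ (nbhs (x, s))).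
    by apply: (@cvg_pair _ _ _ (nbhs x) (nbhs x) (nbhs s)); [exact: cvg_id|exact: cvg_cst].
  exact: differentiable_continuous (dg (x, s) s0).
have cW : forall p : 'rV[R]_n * R, 0 <= p.2 ->
    U @ within [set p : 'rV[R]_n * R | 0 <= p.2] (nbhs p) --> U p.
  by apply/subspace_continuousP.
have cu s : 0 <= s -> continuous (u ^~ s).
  rewrite le_eqVlt => /predU1P[<-|s0]; last exact: (cX U s dU s0).
  (* At s = 0 continuity is given only within the closed half-space; the slice at time 0 stays
     inside it. *)
  move=> x; apply: (@cvg_comp _ _ _ (fun y : 'rV[R]_n => (y, 0)) U _ _ _ _ (cW (x, 0) (lexx 0))).
  move=> A [[B1 B2] /= [xB1 sB2] BA]; apply: filterS xB1 => y By.
  by apply: (BA (y, 0)) => //=; split => //=; exact: nbhs_singleton.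
have cut0 x : u x s @[s --> 0^'+] --> u x 0.
  apply: (@cvg_comp _ _ _ (fun s : R => (x, s)) U _ _ _ _ (cW (x, 0) (lexx 0))).
  move=> A [[B1 B2] /= [xB1 sB2] BA]; apply: filterS sB2 => s Bs s0.
  by apply: (BA (x, s)) => /=; [split => //=; exact: nbhs_singleton|exact: ltW].
have repr z t := @heat_representation R n u (fun x s => 'D_dir_t U (x, s))
  (fun i x s => 'D_(dir_x i) U (x, s)) (fun i x s => 'D_(dir_x i) ('D_(dir_x i) U) (x, s)) M M1
  dut du1 du2 cu (fun i s => cX _ s (dU2 (dir_x i) (dir_x i))) cut0 heat_eq uM utM z t.
have mu_ s : 0 <= s -> measurable_fun setT (u ^~ s).
  by move=> s0; apply: continuous_rV_measurable; exact: cu.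
split.
  move=> tau ybar tau0 yN.
  have p40 : 0 < 4 * pi :> R by rewrite mulr_gt0 ?pi_gt0.
  have pt0 : 0 < 4 * pi * tau by rewrite mulr_gt0.
  have [iu ru] := repr 0 tau tau0.
  have heatE0 (x : 'rV[R]_n) : heat tau 0 x = (4 * pi * tau) `^ (- (n%:R / 2)) * expR (- (enorm x ^+ 2 / (4 * tau))).
    rewrite /heat subr0 enormE mulNr; congr (_ * _).
    rewrite -powR12_sqrt ?ltW// -powRN -powR_mulrn ?powR_ge0// -powRrM; congr (_ `^ _).
    by rewrite mulNr mulrC.
  have c0 : 0 < (4 * pi * tau) `^ (- (n%:R / 2)) by rewrite powR_gt0.
  (* The integrand is the representation of [u 0 tau] without the normalisation of the kernel. *)
  have IE : int_Rn (fun x : 'rV[R]_n => (u x 0 * expR (- (enorm x ^+ 2 / (4 * tau))))%:E)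
      = (((4 * pi * tau) `^ (- (n%:R / 2)))^-1 * u 0 tau)%:E.
    pose g (x : 'rV[R]_n) : R := ((4 * pi * tau) `^ (- (n%:R / 2)))^-1 * (u x 0 * heat tau 0 x).
    have -> : (fun x : 'rV[R]_n => (u x 0 * expR (- (enorm x ^+ 2 / (4 * tau))))%:E) = EFin \o g.
      by apply/funext => x /=; rewrite /g heatE0; congr EFin; field; rewrite gt_eqF.
    rewrite int_RnE.
    - rewrite ru -(RintegralZl _ measurableT iu) /Rintegral fineK//.
      by apply: (integrable_fin_num measurableT); exact: (integrableZl measurableT _ iu).
    - apply/measurable_EFinP/measurable_funM => //; apply: measurable_funM; first exact: mu_.
      exact: measurable_heat.
    - move=> x; rewrite /= lee_fin mulr_ge0 ?invr_ge0 ?ltW// mulr_gt0 ?u0//.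
      by rewrite heatE0 mulr_gt0 ?expR_gt0.
  rewrite IE -EFinM mulrA.
  have -> : (4 * pi) `^ (- (n%:R / 2)) * ((4 * pi * tau) `^ (- (n%:R / 2)))^-1 = tau `^ (n%:R / 2) :> R.
    rewrite -powRN opprK [X in _ * X]powRM ?ltW//.
    rewrite mulrA -powRD; last by rewrite (gt_eqF p40) implybT.
    by rewrite addNr powRr0 mul1r.
  (* The sequence is constant from N = 3 on: the time |y|^2 / (2N) is tau, and R^(m-2) R^(2-N) = R^n
     = (2N)^(n/2) tau^(n/2) cancels the prefactor of v. *)
  apply: cvg_near_cst; near=> N.
  have N3 : (3 <= N)%N by near: N; exact: nbhs_infty_ge.
  have N0 : 0 < N%:R :> R by rewrite ltr0n (leq_trans _ N3).
  have N20 : 0 < 2 * N%:R :> R by rewrite mulr_gt0.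
  have R0 : 0 < 2 * N%:R * tau by rewrite !mulr_gt0.
  congr EFin; rewrite /vfun yN// sqr_sqrtr ?(ltW R0)//.
  rewrite (_ : 2 * N%:R * tau / (2 * N%:R) = tau); last by field; rewrite gt_eqF.
  set r := Num.sqrt _; have r0 : 0 < r by rewrite sqrtr_gt0.
  rewrite mulrA; congr (_ * _); rewrite mulrCA -powRD; last by rewrite (gt_eqF r0) implybT.
  have -> : (n + N)%:R - 2 + (2 - N%:R) = n%:R :> R by rewrite natrD; ring.
  have -> : r `^ n%:R = (2 * N%:R) `^ (n%:R / 2) * tau `^ (n%:R / 2).
    rewrite -powRM ?mulr_ge0 ?(ltW N0) ?(ltW tau0)// /r -powR12_sqrt ?(ltW R0)// -powRrM.
    by rewrite [2^-1 * _]mulrC.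
  rewrite mulrA -powRD; last by rewrite (gt_eqF N20) implybT.
  by rewrite addNr powRr0 mul1r.
move=> u1 t t0.
(* Each Harnack comparison doubles the time, and at every time the mass is 1. *)
pose h (j : nat) (x : 'rV[R]_n) := u x (2 ^+ j * t).
have tj j : 0 < 2 ^+ j * t by rewrite mulr_gt0// exprn_gt0.
have int1 s : 0 < s -> (\int[rVmeas n]_x (u x s)%:E = 1%:E)%E.
  move=> s0; rewrite -int_RnE; first by rewrite u1// ltW.
  - by apply/measurable_EFinP; apply: mu_; exact: ltW.
  - by move=> x; rewrite lee_fin ltW// u0// ltW.
have ch : dominated_chain h.
  split.
  - by move=> j; apply: mu_; exact: ltW.
  - by move=> j x; apply/ltW/u0/ltW.
  - by move=> j; rewrite int1// ltry.
  move=> j; set s := 2 ^+ j * t; have s0 : 0 < s := tj j.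
  exists (Num.sqrt 2 ^+ n * expR (n%:R / (4 * s))).
    by rewrite mulr_ge0 ?expR_ge0// exprn_ge0// sqrtr_ge0.
  move=> x y xy; rewrite /h -/s exprS -mulrA -/s.
  have s20 : 0 < 2 * s by rewrite mulr_gt0.
  have [ix ->] := repr x s s0; have [iy ->] := repr y (2 * s) s20.
  rewrite -(RintegralZl _ measurableT iy); apply: le_Rintegral => //.
    exact: (integrableZl measurableT _ iy).
  move=> w _; rewrite /= [leRHS]mulrCA ler_wpM2l ?(ltW (u0 _ _ _))//.
  exact: heat_harnack.
have h0E : h 0 = u ^~ t by apply/funext => x; rewrite /h expr0 mul1r.
have c0 : continuous (h 0) by rewrite h0E; apply/cu/ltW.
have f0 x : 0 < h 0 x by apply/u0/ltW.
have cD i : continuous (fun x => 'D_(dir_x i) U (x, t)) by exact: (cX _ t (dU1 (dir_x i)) t0).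
have dD i x (b : R) : is_derive b 1 (fun b => h 0 (x + b *: delta_mx ord0 i))
    ('D_(dir_x i) U (x + b *: delta_mx ord0 i, t)).
  by rewrite h0E; exact: du1.
have h1 : (\int[rVmeas n]_x (h 0 x)%:E = 1%:E)%E by exact: int1.
have [_] := entropy_fisher t0 ch c0 f0 cD dD h1.
rewrite h0E ln1.
pose A x := u x t * ln (u x t).
have -> : (fun x : 'rV[R]_n => (Num.max (u x t * (ln (u x t) - 0)) 0)%:E) = (fun x => (Num.max (A x) 0)%:E).
  by apply/funext => x; rewrite subr0.
have -> : (fun x : 'rV[R]_n => (Num.max (- (u x t * (ln (u x t) - 0))) 0)%:E) = (fun x => (Num.max (- A x) 0)%:E).
  by apply/funext => x; rewrite subr0.
have mut := mu_ t (ltW t0).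
have mA : measurable_fun setT A.
  by apply: measurable_funM => //; apply: measurableT_comp => //; exact: measurable_ln.
have maxge0 (r : R) : (0 <= (Num.max r 0)%:E)%E by rewrite lee_fin le_max lexx orbT.
have mpos : measurable_fun setT (fun x => (Num.max (A x) 0)%:E).
  by apply/measurable_EFinP; exact: measurable_maxr.
have mneg : measurable_fun setT (fun x => (Num.max (- A x) 0)%:E).
  by apply/measurable_EFinP; apply: measurable_maxr => //; exact: measurableT_comp.
rewrite /Wfun /sint_Rn (int_RnE mpos)// (int_RnE mneg)//.
set X := (\int[rVmeas n]_x (Num.max (A x) 0)%:E)%E.
set Y := (\int[rVmeas n]_x (Num.max (- A x) 0)%:E)%E.
have mfish i : measurable_fun setT (fun x : 'rV[R]_n => ('D_(dir_x i) U (x, t) ^+ 2 / u x t)%:E).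
  apply/measurable_EFinP; apply: continuous_rV_measurable => x; apply: (@cvgM _ _ (nbhs x)).
    apply: (@cvg_comp _ _ _ (fun y : 'rV[R]_n => 'D_(dir_x i) U (y, t)) (fun r => r ^+ 2)); first exact: cD.
    exact: exprn_continuous.
  by apply: (@cvgV _ _ (nbhs x)); [rewrite gt_eqF// u0// ltW|apply: cu; exact: ltW].
have fish0 i x : (0 <= ('D_(dir_x i) U (x, t) ^+ 2 / u x t)%:E)%E.
  by rewrite lee_fin divr_ge0 ?sqr_ge0// ltW// u0// ltW.
have -> : int_Rn (fun x : 'rV[R]_n => (grad_sq u x t / u x t)%:E) =
    (\sum_(i < n) \int[rVmeas n]_x ('D_(dir_x i) U (x, t) ^+ 2 / u x t)%:E)%E.
  have -> : (fun x : 'rV[R]_n => (grad_sq u x t / u x t)%:E) =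
      (fun x => \sum_(i < n) ('D_(dir_x i) U (x, t) ^+ 2 / u x t)%:E)%E.
    by apply/funext => x; rewrite sumEFin -mulr_suml.
  rewrite int_RnE ?ge0_integral_sum//; first exact: emeasurable_sum.
  by move=> x; exact: sume_ge0.
set I := (\sum_(i < n) _)%E.
have I0 : (0 <= I)%E by apply: sume_ge0 => i _; apply: integral_ge0 => x _.
have Y0 : (0 <= Y)%E by apply: integral_ge0 => x _.
have X0 : (0 <= X)%E by apply: integral_ge0 => x _.
(* [sint_Rn] is a difference of two integrals. Since u <= M, u ln u is at most u max(ln M, 0), so
   the positive part is finite and oo - oo does not occur. *)
have Xfin : (X < +oo)%E.
  pose c := Num.max (ln M) 0.
  have cc0 : 0 <= c by rewrite le_max lexx orbT.
  apply: (@le_lt_trans _ _ (c%:E * \int[rVmeas n]_x (u x t)%:E)%E); last by rewrite int1// mule1 ltry.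
  rewrite -ge0_integralZl; [|by []|exact/measurable_EFinP|by move=> x _; rewrite lee_fin ltW// u0// ltW|by rewrite lee_fin].
  apply: ge0_le_integral; [by []|by move=> x _|by []|by apply: measurable_funeM; exact/measurable_EFinP|].
  move=> x _; rewrite -EFinM lee_fin; have ux := u0 x t (ltW t0).
  rewrite ge_max mulr_ge0 ?(ltW ux)// andbT /A mulrC ler_wpM2r ?(ltW ux)//.
  have uxM : u x t <= M by rewrite (le_trans (ler_norm _))// uM// ltW.
  by rewrite le_max ler_ln ?posrE// ?uxM// (lt_le_trans ux).
have ln4 : ln (4 * pi * t) = ln (4 * pi) + ln t by rewrite lnM ?posrE// mulr_gt0 ?pi_gt0.
set cp := Num.max (1 + _) 0; set cm := Num.max (- _) 0.
have cpm : cp - cm = 1 + (ln (4 * pi) + ln t) / 2.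
  by rewrite -ln4 /cp /cm /Num.max; case: ifPn; case: ifPn; rewrite -?leNgt; lra.
rewrite !mulr1; case: X X0 Xfin => [X||]// _ _.
have : (0 <= t%:E * I)%E by rewrite mule_ge0// lee_fin ltW.
(* An infinite Fisher term or an infinite negative part makes [Wfun] equal to +oo; otherwise all
   quantities are real. *)
case: (t%:E * I)%E => [J||]// _; case: Y Y0 => [Y||]// _; rewrite ?leey//=.
rewrite -!EFinB -!EFinD !lee_fin => hJ.
(* n times [cpm] contains the (n/2) ln t that [Wfun] subtracts. *)
have := congr1 (fun r => n%:R * r) cpm; rewrite mulrBr => hn.
lra.
Unshelve. all: by end_near. Qed.
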